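(* Assume the genericity condition (Gen) and set, for $n<j\le p$ and $l,k\ge0$, $$c^{(j)}_{l,k}:=\operatorname*{Res}_{s=a_j+l\tau+k}\mathcal G(s),\qquad s_0=a_j+l\tau+k .$$ If $F$ and $H$ are regular at $s_0$, then $$c^{(j)}_{l,k+1}=F(s_0)\,c^{(j)}_{l,k},\qquad c^{(j)}_{l+1,k}=H(s_0)\,c^{(j)}_{l,k}.$$ The analogous coefficients on $\Lambda^-$, $c^-_{l,k}:=\operatorname{Res}_{s=s_0}\mathcal G(s)$ with $s_0=b_j-l\tau-k$ ($m<j\le q$, $l,k\ge1$), obey (under the analogous regularity, $F$ regular and non-zero at $s_0-1$, $H$ regular and non-zero at $s_0-\tau$) the inverse relations $c^-_{l,k+1}=c^-_{l,k}/F(s_0-1)$ and $c^-_{l+1,k}=c^-_{l,k}/H(s_0-\tau)$. The two recurrences are compatible: $$F(s+\tau)\,H(s)=H(s+1)\,F(s),$$ so the value of $c^{(j)}_{l,k}$ does not depend on the lattice path used to reach it: path-independence holds on every connected subset of the lattice $\{(l,k):l,k\ge0\}$ on which all the multipliers appearing in the recurrences $c^{(j)}_{l,k+1}=F(s_0)c^{(j)}_{l,k}$, $c^{(j)}_{l+1,k}=H(s_0)c^{(j)}_{l,k}$ are finite and non-zero.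
   Context: For $\tau>0$, $G(z;\tau)$ is the Barnes double gamma function: the entire function $G(z;\tau)=\frac{z}{\tau}e^{c_1 z/\tau+c_2 z^2/(2\tau^2)}\prod_{(k,l)\in\mathbb{Z}_{\ge0}^2\setminus\{(0,0)\}}\big(1+\frac{z}{k\tau+l}\big)e^{-\frac{z}{k\tau+l}+\frac{z^2}{2(k\tau+l)^2}}$, with real constants $c_1,c_2$ (depending on $\tau$) uniquely determined by $G(z+1;\tau)=\Gamma(z/\tau)G(z;\tau)$ and $G(z+\tau;\tau)=(2\pi)^{(\tau-1)/2}\tau^{1/2-z}\Gamma(z)G(z;\tau)$. Let $\tau>0$, $0\le m\le q$, $0\le n\le p$ integers, $\mathbf a\in\mathbb{C}^p$, $\mathbf b\in\mathbb{C}^q$, and $$\mathcal G(s)=\frac{\prod_{j=1}^{m}G(b_j-s;\tau)\prod_{j=1}^{n}G(1+\tau-a_j+s;\tau)}{\prod_{j=m+1}^{q}G(1+\tau-b_j+s;\tau)\prod_{j=n+1}^{p}G(a_j-s;\tau)},\qquad N=2(m+n)-p-q,$$ $\mu=\sum_{j\le n}a_j-\sum_{n<j\le p}a_j+\sum_{j\le m}b_j-\sum_{m<j\le q}b_j$, $\Lambda^-=\{b_j-l\tau-k: m<j\le q,\ l,k\in\mathbb{Z}_{\ge1}\}$. The functions $F,H$, which satisfy $\mathcal G(s+1)=F(s)\mathcal G(s)$ and $\mathcal G(s+\tau)=H(s)\mathcal G(s)$, are $$F(s)=\frac{\prod_{j=1}^{n}\Gamma\big(1+\frac{1-a_j+s}{\tau}\big)\prod_{j=n+1}^{p}\Gamma\big(\frac{a_j-s-1}{\tau}\big)}{\prod_{j=1}^{m}\Gamma\big(\frac{b_j-s-1}{\tau}\big)\prod_{j=m+1}^{q}\Gamma\big(1+\frac{1-b_j+s}{\tau}\big)},$$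 $$H(s)=(2\pi)^{\frac{(\tau-1)(p-q)}{2}}\tau^{\mu-N(\tau+\frac12)}\tau^{-sN}\frac{\prod_{j=1}^{n}\Gamma(1+\tau-a_j+s)\prod_{j=n+1}^{p}\Gamma(a_j-\tau-s)}{\prod_{j=1}^{m}\Gamma(b_j-\tau-s)\prod_{j=m+1}^{q}\Gamma(1+\tau-b_j+s)}.$$ (Gen): $\tau\notin\mathbb{Q}$; $a_i-a_j\notin\mathbb{Z}+\tau\mathbb{Z}$ for $1\le i<j\le p$; $b_i-b_j\notin\mathbb{Z}+\tau\mathbb{Z}$ for $1\le i<j\le q$; $a_i-b_j\notin\mathbb{Z}+\tau\mathbb{Z}$ for all $i,j$. *)

(* Defs.v *)
From HB Require Import structures.
From mathcomp Require Export all_boot.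
From Stdlib Require Export Reals QArith.
From Coquelicot Require Export Coquelicot.

Set Implicit Arguments.
Unset Strict Implicit.
Unset Printing Implicit Defensive.

(* Rebound to N_scope by the imports. *)
Delimit Scope nat_scope with N.

Open Scope R_scope.
Open Scope C_scope.

HB.instance Definition _ :=
  Monoid.isComLaw.Build C (RtoC 0) Cplus Cplus_assoc Cplus_comm Cplus_0_l.
HB.instance Definition _ :=
  Monoid.isComLaw.Build C (RtoC 1) Cmult Cmult_assoc Cmult_comm Cmult_1_l.

Notation "\Csum_ ( i < n | P ) F" :=
  (\big[Cplus/RtoC 0]_(i < n | P) F%C)
  (at level 41, i, n at level 50, F at level 41).
Notation "\Cprod_ ( i < n | P ) F" :=
  (\big[Cmult/RtoC 1]_(i < n | P) F%C)
  (at level 36, i, n at level 50, F at level 36).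
Notation "\Cprod_ ( i < n ) F" :=
  (\big[Cmult/RtoC 1]_(i < n) F%C)
  (at level 36, i, n at level 50, F at level 36).

(* Unspecified when the limit does not exist. *)
Definition Clim {T : Type} (D : (T -> Prop) -> Prop) (f : T -> C) : C :=
  iota (T := C_CompleteNormedModule) (fun l : C => filterlim f D (locally l)).

Definition Cexp (z : C) : C :=
  ((exp (Re z) * cos (Im z))%R, (exp (Re z) * sin (Im z))%R).

(* x ^ w for x > 0, with the real logarithm of x. *)
Definition Rcpow (x : R) (w : C) : C := Cexp (w * ln x).

Definition nonpos_int (z : C) : Prop := exists k : nat, z = - INR k.

(* Euler's limit  n! n^z / (z (z+1) ... (z+n)).  Since / 0 = 0, the value at a
   pole is 0, so that / CGamma z is the entire function 1/Gamma. *)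
Definition CGamma (z : C) : C :=
  Clim eventually (fun n : nat =>
    INR n`! * Rcpow (INR n) z / \Cprod_(k < n.+1) (z + INR k)).

(* The double product over (k, l) <> (0, 0) converges absolutely; it is taken
   as the limit of its partial products over squares. *)
Definition barnes_product (tau : R) (z : C) : C :=
  Clim eventually (fun M : nat =>
    \Cprod_(k < M) \Cprod_(l < M | (0 < k + l)%N)
      ((1 + z / (INR k * tau + INR l))
       * Cexp (- (z / (INR k * tau + INR l))
               + z ^ 2 / (2 * (INR k * tau + INR l) ^ 2)))).

(* At a pole of the Gamma factor the functional equations only hold in the
   limit, hence the side conditions. *)
Definition is_double_gamma (tau : R) (G : C -> C) : Prop :=
  exists c1 c2 : R,
    [/\ forall z : C,
          G z = z / tau * Cexp (c1 * z / tau + c2 * z ^ 2 / (2 * tau ^ 2))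
                * barnes_product tau z,
        forall z : C, ~ nonpos_int (z / tau) ->
          G (z + 1) = CGamma (z / tau) * G z
      & forall z : C, ~ nonpos_int z ->
          G (z + tau) = Rcpow (2 * PI) ((tau - 1) / 2) * Rcpow tau (1 / 2 - z)
                        * CGamma z * G z].

(* In the families below the index i : 'I_q stands for j = i + 1, so that
   1 <= j <= m reads i < m and m < j <= q reads m <= i. *)

Definition calG (G : C -> C) (tau : R) (p q m n : nat)
    (a : 'I_p -> C) (b : 'I_q -> C) (s : C) : C :=
  (\Cprod_(j < q | (j < m)%N) G (b j - s)
   * \Cprod_(j < p | (j < n)%N) G (1 + tau - a j + s))
  / (\Cprod_(j < q | (m <= j)%N) G (1 + tau - b j + s)
     * \Cprod_(j < p | (n <= j)%N) G (a j - s)).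

Definition calN (p q m n : nat) : R :=
  (2 * (INR m + INR n) - INR p - INR q)%R.

Definition calmu (p q m n : nat) (a : 'I_p -> C) (b : 'I_q -> C) : C :=
  \Csum_(j < p | (j < n)%N) a j - \Csum_(j < p | (n <= j)%N) a j
  + \Csum_(j < q | (j < m)%N) b j - \Csum_(j < q | (m <= j)%N) b j.

Definition calF (tau : R) (p q m n : nat)
    (a : 'I_p -> C) (b : 'I_q -> C) (s : C) : C :=
  (\Cprod_(j < p | (j < n)%N) CGamma (1 + (1 - a j + s) / tau)
   * \Cprod_(j < p | (n <= j)%N) CGamma ((a j - s - 1) / tau))
  / (\Cprod_(j < q | (j < m)%N) CGamma ((b j - s - 1) / tau)
     * \Cprod_(j < q | (m <= j)%N) CGamma (1 + (1 - b j + s) / tau)).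

Definition calH (tau : R) (p q m n : nat)
    (a : 'I_p -> C) (b : 'I_q -> C) (s : C) : C :=
  Rcpow (2 * PI) ((tau - 1) * (INR p - INR q) / 2)
  * Rcpow tau (calmu m n a b - calN p q m n * (tau + 1 / 2))
  * Rcpow tau (- s * calN p q m n)
  * ((\Cprod_(j < p | (j < n)%N) CGamma (1 + tau - a j + s)
      * \Cprod_(j < p | (n <= j)%N) CGamma (a j - tau - s))
     / (\Cprod_(j < q | (j < m)%N) CGamma (b j - tau - s)
        * \Cprod_(j < q | (m <= j)%N) CGamma (1 + tau - b j + s))).

Definition in_lattice (tau : R) (z : C) : Prop :=
  exists u v : Z, z = IZR u + tau * IZR v.

Definition generic (tau : R) (p q : nat)
    (a : 'I_p -> C) (b : 'I_q -> C) : Prop :=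
  [/\ forall r : Q, tau <> Q2R r,
      forall i j : 'I_p, (i < j)%N -> ~ in_lattice tau (a i - a j),
      forall i j : 'I_q, (i < j)%N -> ~ in_lattice tau (b i - b j)
    & forall (i : 'I_p) (j : 'I_q), ~ in_lattice tau (a i - b j)].

(* For calF and calH under [generic], no pole of a factor is cancelled by a zero
   of another one, so this is regularity of the meromorphic function: the
   placeholder value 0 at a pole never makes the function differentiable. *)
Definition regular_at (f : C -> C) (s0 : C) : Prop :=
  locally s0 (fun s : C => ex_derive (K := C_AbsRing) (V := C_NormedModule) f s).

Definition regular_nonzero_at (f : C -> C) (s0 : C) : Prop :=
  regular_at f s0 /\ f s0 <> 0.

Definition circle_integral (f : C -> C) (s0 : C) (rho : R) : C :=
  RInt (V := C_R_CompleteNormedModule)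
    (fun t : R => f (s0 + rho * Cexp (Ci * t)) * (Ci * rho * Cexp (Ci * t)))
    0 (2 * PI).

(* At an isolated singularity the integral does not depend on the radius once
   the latter is small; the limit selects this common value. *)
Definition Residue (f : C -> C) (s0 : C) : C :=
  Clim (at_right 0) (fun rho : R => circle_integral f s0 rho / (2 * PI * Ci)).

(* Points (l, k) of the quarter lattice, two of them being neighbours when they
   differ by one in exactly one coordinate. *)
Definition lattice_step (x y : nat * nat) : bool :=
  [|| y == (x.1, x.2.+1), y == (x.1.+1, x.2),
      x == (y.1, y.2.+1) | x == (y.1.+1, y.2)].

Definition lattice_path (S : nat * nat -> Prop)
    (x : nat * nat) (w : seq (nat * nat)) (y : nat * nat) : Prop :=
  [/\ path lattice_step x w, last x w = y & forall z, z \in x :: w -> S z].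

Definition lattice_connected (S : nat * nat -> Prop) : Prop :=
  forall x y, S x -> S y -> exists w, lattice_path S x w y.

(* f1 and f2 are the multipliers of (l, k) -> (l, k + 1) and
   (l, k) -> (l + 1, k); a step backwards divides. *)
Definition step_multiplier (f1 f2 : nat * nat -> C) (x y : nat * nat) : C :=
  if y == (x.1, x.2.+1) then f1 x
  else if y == (x.1.+1, x.2) then f2 x
  else if x == (y.1, y.2.+1) then / f1 y
  else / f2 y.

Fixpoint path_multiplier (f1 f2 : nat * nat -> C)
    (x : nat * nat) (w : seq (nat * nat)) : C :=
  if w is y :: w' then step_multiplier f1 f2 x y * path_multiplier f1 f2 y w'
  else 1.

(* Main.v *)
Require Import Defs.
From Stdlib Require Import Lra Lia Classical.
From Stdlib Require Qreals.
From mathcomp Require Import zify.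

Set Implicit Arguments.
Unset Strict Implicit.
Unset Printing Implicit Defensive.

Open Scope R_scope.
Open Scope C_scope.

(** Why the theorem is true.

    Everything rests on two facts about the double gamma function [G], for
    irrational [tau]: it is continuous, and its zeros are exactly the points
    [- (k tau + l)] with [k, l >= 0], all simple.  Both are read off the product:
    on a disc, a finite square of factors is split off, and the remaining shells
    [max (k, l) = M] contribute factors at distance [O(1 / M^2)] from one, because
    each canonical factor is one up to third order.  Hence [G] is a finite product
    of linear factors times a continuous function without zeros
    ([double_gamma_local]).

    At a point where no factor of the quotient [g] vanishes, the functional
    equations of [G] give [g (s + 1) = F s * g s] and [g (s + tau) = H s * g s]
    ([calG_shift1], [calG_shift_tau]).  No information on the Gamma function is
    needed: at such a point its value is a quotient of two nonzero values of [G].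
    The exceptional points are isolated, so both relations hold in a punctured
    neighbourhood of every point.

    The residue at an isolated singularity is the limit of [(s - s0) * g s] as
    soon as this limit exists and [g] is continuous near [s0] ([Residue_eq]).
    Genericity forces exactly one factor of the denominator, and none of the
    numerator, to vanish at a point of either lattice, so the limit exists and is
    not zero ([calG_pole_right], [calG_pole_left]).  Multiplying the functional
    equation by [s - s0] and letting [s] tend to [s0] gives the recurrences; a
    regular multiplier is continuous, which is all that is used.  Evaluating
    [g (s + 1 + tau)] in two ways gives the compatibility relation.  Finally the
    residues are nonzero, and a path multiplies the residue by its multiplier
    ([path_multiplier_ratio]): the multiplier is the quotient of the residues at
    the two ends, and does not depend on the path. *)

(** * Limits of complex-valued functions *)

(** Convergence of a complex-valued function along a filter, for the product
    topology of the complex plane. *)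
Definition tends {T : Type} (D : (T -> Prop) -> Prop) (f : T -> C) (l : C) :=
  filterlim f D (locally l).

Lemma locally_CmodP (z : C) (P : C -> Prop) :
  locally z P <-> exists2 d : R, (0 < d)%R & forall y, (Cmod (y - z) < d)%R -> P y.
Proof.
split.
  move/(locally_C (z : C_UniformSpace) P) => [d Hd].
  exists (pos d); first exact: cond_pos.
  by move=> y Hy; apply: Hd.
case=> d d0 Hd; apply/(locally_C (z : C_UniformSpace) P).
by exists (mkposreal d d0) => y Hy; apply: Hd.
Qed.

Lemma locally'_CmodP (z : C) (P : C -> Prop) :
  locally' z P <->
  exists2 d : R, (0 < d)%R & forall y, y <> z -> (Cmod (y - z) < d)%R -> P y.
Proof.
rewrite /locally' /within.
split.
  by move/locally_CmodP => [d d0 Hd]; exists d => // y yz Hy; apply: Hd.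
by case=> d d0 Hd; apply/locally_CmodP; exists d => // y Hy yz; apply: Hd.
Qed.

Lemma filterS {T : Type} (D : (T -> Prop) -> Prop) {FD : Filter D} (P Q : T -> Prop) :
  D P -> (forall x, P x -> Q x) -> D Q.
Proof. by move=> HP PQ; apply: filter_imp HP. Qed.

Lemma tendsP {T : Type} (D : (T -> Prop) -> Prop) {FD : Filter D} (f : T -> C) (l : C) :
  tends D f l <-> forall e : R, (0 < e)%R -> D (fun x => (Cmod (f x - l) < e)%R).
Proof.
split=> [H e e0|H P].
  apply: (H (fun y => (Cmod (y - l) < e)%R)).
  by apply/locally_CmodP; exists e.
move/locally_CmodP => [d d0 Hd].
by rewrite /filtermap; apply: (filterS (H d d0)) => x; apply: Hd.
Qed.

Global Instance locally'_C_filter (z : C) : ProperFilter (locally' z).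
Proof.
split; last by rewrite /locally'; apply: within_filter.
move=> P /locally'_CmodP [d d0 Hd]; exists (z + (d / 2)%R); apply: Hd.
  move=> E; have /(f_equal (@fst R R)) /= : RtoC (d / 2) = 0.
    have -> : RtoC (d / 2) = (z + RtoC (d / 2)) - z by ring.
    rewrite E; ring.
  lra.
have -> : z + RtoC (d / 2) - z = RtoC (d / 2) by ring.
rewrite Cmod_R Rabs_right; lra.
Qed.

Section TendsTheory.
Context {T : Type} (D : (T -> Prop) -> Prop) {FD : Filter D}.

Lemma tends_const (c : C) : tends D (fun=> c) c.
Proof. exact: filterlim_const. Qed.
Arguments tends_const : clear implicits.

Lemma tends_ext_loc (f g : T -> C) (l : C) :
  tends D f l -> D (fun x => f x = g x) -> tends D g l.
Proof. by move=> H E; apply: filterlim_ext_loc H. Qed.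

Lemma tends_ext (f g : T -> C) (l : C) :
  tends D f l -> (forall x, f x = g x) -> tends D g l.
Proof. by move=> H E; apply: filterlim_ext H. Qed.

Lemma tends_add (f g : T -> C) (l k : C) :
  tends D f l -> tends D g k -> tends D (fun x => f x + g x) (l + k).
Proof.
move=> /tendsP Hf /tendsP Hg; apply/tendsP => e e0.
have e2 : (0 < e / 2)%R by lra.
apply: (filterS (filter_and _ _ (Hf _ e2) (Hg _ e2))) => x [H1 H2].
have -> : f x + g x - (l + k) = (f x - l) + (g x - k) by ring.
apply: Rle_lt_trans (Cmod_triangle _ _) _; lra.
Qed.

Lemma tends_mul (f g : T -> C) (l k : C) :
  tends D f l -> tends D g k -> tends D (fun x => f x * g x) (l * k).
Proof.
move=> /tendsP Hf /tendsP Hg; apply/tendsP => e e0.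
have l0 := Cmod_ge_0 l; have k0 := Cmod_ge_0 k.
set d := Rmin 1 (e / (Cmod l + Cmod k + 2)).
have q0 : (0 < e / (Cmod l + Cmod k + 2))%R by apply: Rdiv_lt_0_compat; lra.
have d0 : (0 < d)%R by apply: Rmin_glb_lt; lra.
have d1 : (d <= 1)%R := Rmin_l _ _.
have d2 : (d * (Cmod l + Cmod k + 2) <= e)%R.
  have : (d <= e / (Cmod l + Cmod k + 2))%R := Rmin_r _ _.
  move/(Rmult_le_compat_r (Cmod l + Cmod k + 2)) => H.
  apply: Rle_trans (H _) _; first lra.
  by right; field; lra.
apply: (filterS (filter_and _ _ (Hf d d0) (Hg d d0))) => x [H1 H2].
have -> : f x * g x - l * k = (f x - l) * (g x - k) + (f x - l) * k + l * (g x - k) by ring.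
have p1 := Cmod_ge_0 (f x - l); have p2 := Cmod_ge_0 (g x - k).
apply: Rle_lt_trans (Cmod_triangle _ _) _.
apply: Rle_lt_trans (Rplus_le_compat_r _ _ _ (Cmod_triangle _ _)) _.
rewrite !Cmod_mult; nra.
Qed.

Lemma tends_opp (f : T -> C) (l : C) :
  tends D f l -> tends D (fun x => - f x) (- l).
Proof.
move=> Hf; have -> : - l = (- RtoC 1) * l by ring.
apply: (tends_ext (tends_mul (tends_const (- RtoC 1)) Hf)) => x; ring.
Qed.

Lemma tends_neq0 (f : T -> C) (l : C) :
  l <> 0 -> tends D f l -> D (fun x => f x <> 0).
Proof.
move=> /Cmod_gt_0 l0 /tendsP Hf; apply: (filterS (Hf _ l0)) => x Hx E.
move: Hx; rewrite E; have -> : 0 - l = - l by ring.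
rewrite Cmod_opp; lra.
Qed.

Lemma tends_inv (f : T -> C) (l : C) :
  l <> 0 -> tends D f l -> tends D (fun x => / f x) (/ l).
Proof.
move=> l0 Hf; have L0 : (0 < Cmod l)%R by apply/Cmod_gt_0.
have fn0 := tends_neq0 l0 Hf.
move: Hf => /tendsP Hf; apply/tendsP => e e0.
set d := Rmin (Cmod l / 2) (e * Cmod l * Cmod l / 2).
have d0 : (0 < d)%R.
  apply: Rmin_glb_lt; first lra.
  by have := Rmult_lt_0_compat _ _ (Rmult_lt_0_compat _ _ e0 L0) L0; lra.
have d1 : (d <= Cmod l / 2)%R := Rmin_l _ _.
have d2 : (d <= e * Cmod l * Cmod l / 2)%R := Rmin_r _ _.
apply: (filterS (filter_and _ _ (Hf d d0) fn0)) => x [H1 f0].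
have F0 : (Cmod l / 2 < Cmod (f x))%R.
  have : (Cmod l <= Cmod (f x) + Cmod (f x - l))%R.
    have {1}-> : l = f x + - (f x - l) by ring.
    by rewrite -(Cmod_opp (f x - l)); apply: Cmod_triangle.
  lra.
have -> : / f x - / l = - (f x - l) / (f x * l) by field.
rewrite Cmod_div; last exact: Cmult_neq_0.
rewrite Cmod_opp Cmod_mult.
have fl0 : (0 < Cmod (f x) * Cmod l)%R by apply: Rmult_lt_0_compat; lra.
apply: (Rmult_lt_reg_r (Cmod (f x) * Cmod l)) => //.
have -> : (Cmod (f x - l) / (Cmod (f x) * Cmod l) * (Cmod (f x) * Cmod l))%R
  = Cmod (f x - l) by field; lra.
have : (e * Cmod l * (Cmod l / 2) < e * Cmod l * Cmod (f x))%R.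
  by apply: Rmult_lt_compat_l => //; apply: Rmult_lt_0_compat.
lra.
Qed.

Lemma tends_div (f g : T -> C) (l k : C) :
  k <> 0 -> tends D f l -> tends D g k -> tends D (fun x => f x / g x) (l / k).
Proof. by move=> k0 Hf Hg; apply: tends_mul => //; apply: tends_inv. Qed.

Lemma tends_prod (I : Type) (r : seq I) (P : pred I) (f : I -> T -> C) (l : I -> C) :
  (forall i, P i -> tends D (f i) (l i)) ->
  tends D (fun x => \big[Cmult/RtoC 1]_(i <- r | P i) f i x)
    (\big[Cmult/RtoC 1]_(i <- r | P i) l i).
Proof.
move=> H; elim: r => [|i r IH].
  rewrite big_nil; apply: (tends_ext (tends_const 1)) => x.
  by rewrite big_nil.
rewrite big_cons; case: ifP => Pi.
  apply: (tends_ext (tends_mul (H i Pi) IH)) => x.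
  by rewrite big_cons Pi.
by apply: (tends_ext IH) => x; rewrite big_cons Pi.
Qed.

End TendsTheory.
Arguments tends_const {T D FD} c.

Lemma tends_unique {T : Type} (D : (T -> Prop) -> Prop) {PD : ProperFilter D}
    (f : T -> C) (l k : C) : tends D f l -> tends D f k -> l = k.
Proof.
move=> /tendsP Hl /tendsP Hk; case: (Ceq_dec l k) => // lk.
have /Cmod_gt_0 d0 := Cminus_eq_contra _ _ lk.
have d2 : (0 < Cmod (l - k) / 2)%R by lra.
have [x [H1 H2]] := filter_ex _ (filter_and _ _ (Hl _ d2) (Hk _ d2)).
have : (Cmod (l - k) <= Cmod (f x - k) + Cmod (f x - l))%R.
  have -> : l - k = (f x - k) + - (f x - l) by ring.
  by rewrite -(Cmod_opp (f x - l)); apply: Cmod_triangle.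
lra.
Qed.

Lemma tends_comp {T U : Type} (D : (T -> Prop) -> Prop) (E : (U -> Prop) -> Prop)
    (h : T -> U) (f : U -> C) (l : C) :
  filterlim h D E -> tends E f l -> tends D (fun x => f (h x)) l.
Proof. exact: filterlim_comp. Qed.

Lemma Clim_eq {T : Type} (D : (T -> Prop) -> Prop) {PD : ProperFilter D}
    (f : T -> C) (l : C) : tends D f l -> Clim D f = l.
Proof.
exact: (@iota_filterlim_locally _ C_CompleteNormedModule _ _ (Proper_StrongProper _ PD)).
Qed.

(** Continuity of a function of a complex variable. *)
Definition cont (f : C -> C) (z : C) := tends (locally z) f (f z).

Lemma tends_locally' (f : C -> C) (z l : C) : tends (locally z) f l -> tends (locally' z) f l.
Proof.
move=> /tendsP H; apply/tendsP => e e0.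
by apply: (filterS (H e e0)) => x Hx _.
Qed.

(** An affine map with nonzero slope sends punctured neighbourhoods into
    punctured neighbourhoods. *)
Lemma locally'_affine (u v z : C) : u <> 0 ->
  filterlim (fun s => u * s + v) (locally' z) (locally' (u * z + v)).
Proof.
move=> u0 P /locally'_CmodP [d d0 Hd].
have U0 : (0 < Cmod u)%R by apply/Cmod_gt_0.
apply/locally'_CmodP; exists (d / Cmod u)%R; first exact: Rdiv_lt_0_compat.
move=> y yz Hy; have E : u * y + v - (u * z + v) = u * (y - z) by ring.
apply: Hd.
  move=> E2; apply: yz.
  have -> : y = / u * (u * y + v - v) by field.
  by rewrite E2; field.
rewrite E Cmod_mult.
have := Rmult_lt_compat_l _ _ _ U0 Hy.
by have -> : (Cmod u * (d / Cmod u))%R = d by field; lra.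
Qed.

Lemma locally_affine (u v z : C) :
  filterlim (fun s => u * s + v) (locally z) (locally (u * z + v)).
Proof.
apply: (@tends_add _ (locally z) _ (fun s => u * s) (fun=> v)); last exact: tends_const.
by apply: tends_mul (tends_const u) _; apply: filterlim_id.
Qed.

Lemma regular_cont (f : C -> C) (z : C) : regular_at f z -> cont f z.
Proof.
move=> /locally_singleton H P HP.
by have /(_ P HP) /locally_C := ex_derive_continuous _ _ H.
Qed.

Lemma tends_pair {T : Type} (D : (T -> Prop) -> Prop) {FD : Filter D}
    (u v : T -> R) (x y : R) :
  filterlim u D (locally x) -> filterlim v D (locally y) ->
  tends D (fun t => (u t, v t)) (x, y).
Proof.
move=> /filterlim_locally Hu /filterlim_locally Hv; apply/filterlim_locally => e.
by apply: (filterS (filter_and _ _ (Hu e) (Hv e))) => t [].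
Qed.

Lemma tends_RtoC {T : Type} (D : (T -> Prop) -> Prop) {FD : Filter D}
    (u : T -> R) (x : R) :
  filterlim u D (locally x) -> tends D (fun t => RtoC (u t)) (RtoC x).
Proof. by move=> Hu; apply: tends_pair Hu (filterlim_const _). Qed.

Lemma Cexp_cont (z : C) : cont Cexp z.
Proof.
apply: tends_pair.
- apply: (@continuous_mult _ R_AbsRing (fun z : C => exp (Re z)) (fun z : C => cos (Im z))).
    by apply: (continuous_comp Re exp); [exact: continuous_fst | exact: continuous_exp].
  by apply: (continuous_comp Im cos); [exact: continuous_snd | exact: continuous_cos].
apply: (@continuous_mult _ R_AbsRing (fun z : C => exp (Re z)) (fun z : C => sin (Im z))).
  by apply: (continuous_comp Re exp); [exact: continuous_fst | exact: continuous_exp].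
by apply: (continuous_comp Im sin); [exact: continuous_snd | exact: continuous_sin].
Qed.

Lemma tends_Cexp {T : Type} (D : (T -> Prop) -> Prop) {FD : Filter D}
    (f : T -> C) (l : C) :
  tends D f l -> tends D (fun t => Cexp (f t)) (Cexp l).
Proof. by move=> Hf; apply: (tends_comp Hf (@Cexp_cont l)). Qed.

Lemma Cmod_Cexp (z : C) : Cmod (Cexp z) = exp (Re z).
Proof.
have e0 := exp_pos (Re z).
rewrite /Cmod /Cexp /=.
have -> : (exp (Re z) * cos (Im z) * (exp (Re z) * cos (Im z) * 1)
   + exp (Re z) * sin (Im z) * (exp (Re z) * sin (Im z) * 1)
   = Rsqr (exp (Re z)))%R.
  have := sin2_cos2 (Im z); rewrite /Rsqr => H.
  transitivity (exp (Re z) * exp (Re z) *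
    (sin (Im z) * sin (Im z) + cos (Im z) * cos (Im z)))%R; first ring.
  rewrite H; ring.
by apply: sqrt_Rsqr; lra.
Qed.

Lemma Cexp_neq0 (z : C) : Cexp z <> 0.
Proof.
move=> /(f_equal Cmod); rewrite Cmod_Cexp Cmod_0; have := exp_pos (Re z); lra.
Qed.

Lemma Cexp_add (z w : C) : Cexp (z + w) = Cexp z * Cexp w.
Proof.
rewrite /Cexp /Cmult /= exp_plus cos_plus sin_plus /Re /Im.
by f_equal; ring.
Qed.

Lemma Cexp_0 : Cexp 0 = 1.
Proof. by rewrite /Cexp /= exp_0 cos_0 sin_0 /RtoC; f_equal; ring. Qed.

(** * Residues *)

(** If [(s - s0) f s] has a limit at [s0], that limit is the residue: on small
    circles the integrand is uniformly close to a constant.  Continuity of [f]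
    near [s0] makes the integrals meaningful. *)
Lemma Residue_eq (f : C -> C) (s0 c : C) :
  locally' s0 (cont f) -> tends (locally' s0) (fun s => (s - s0) * f s) c ->
  Residue f s0 = c.
Proof.
move=> fc /tendsP fl; apply: Clim_eq; apply/tendsP => e e0.
have pi0 := PI_RGT_0.
have e2 : (0 < e / 2)%R by lra.
have [d d0 Hd] : exists2 d : R, (0 < d)%R & forall y, y <> s0 ->
    (Cmod (y - s0) < d)%R -> cont f y /\ (Cmod ((y - s0) * f y - c) < e / 2)%R.
  by apply/locally'_CmodP; apply: filter_and fc (fl _ e2).
exists (mkposreal d d0) => rho /= Hrho rho0.
have {Hrho} rhod : (rho < d)%R.
  move: Hrho; rewrite /ball /= /AbsRing_ball /abs /minus /plus /opp /=.
  by rewrite Ropp_0 Rplus_0_r Rabs_right //; lra.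
set z := fun t : R => s0 + rho * Cexp (Ci * t).
have zE t : z t - s0 = rho * Cexp (Ci * t) by rewrite /z; ring.
have zmod t : Cmod (z t - s0) = rho.
  rewrite zE Cmod_mult Cmod_R Cmod_Cexp /= Rabs_right; last lra.
  by rewrite Rmult_0_l Rmult_0_r Rminus_0_r exp_0 Rmult_1_r.
have zd t : (Cmod (z t - s0) < d)%R by rewrite zmod.
have zn t : z t <> s0.
  move=> E; have := zmod t; rewrite E.
  have -> : s0 - s0 = 0 by ring.
  rewrite Cmod_0; lra.
have expt t : tends (locally t) (fun t : R => Cexp (Ci * t)) (Cexp (Ci * t)).
  apply: tends_Cexp; apply: tends_mul (tends_const _) _.
  apply: tends_RtoC; exact: filterlim_id.
set phi := fun t : R => f (z t) * (Ci * rho * Cexp (Ci * t)).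
have phic t : tends (locally t) phi (phi t).
  apply: tends_mul; last exact: tends_mul (tends_const _) (expt t).
  apply: (@tends_comp _ _ _ (locally (z t)) z); last by have [] := Hd _ (zn t) (zd t).
  by apply: tends_add (tends_const _) _; apply: tends_mul (tends_const _) (expt t).
have ex : ex_RInt (V := C_R_CompleteNormedModule) phi 0 (2 * PI).
  by apply: ex_RInt_continuous => t _; apply: phic.
have I := RInt_correct (V := C_R_CompleteNormedModule) _ _ _ ex.
have J := is_RInt_const (V := C_R_NormedModule) 0 (2 * PI) (Ci * c).
have K := is_RInt_minus _ _ _ _ _ _ I J.
have B : (0 <= 2 * PI)%R by lra.
have /(_ (e / 2)%R) := norm_RInt_le_const _ _ _ _ _ B _ K.
rewrite -Cmod_norm => /(_ _)/[dup] L1 _.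
have L : (Cmod (circle_integral f s0 rho - 2 * PI * Ci * c) <= 2 * PI * (e / 2))%R.
  have -> : (2 * PI * (e / 2))%R = ((2 * PI - 0) * (e / 2))%R by ring.
  have -> : circle_integral f s0 rho - 2 * PI * Ci * c
    = minus (circle_integral f s0 rho) (scal (2 * PI - 0)%R (Ci * c)).
    rewrite scal_R_Cmult RtoC_minus RtoC_mult /minus /plus /opp /=; ring.
  apply: L1 => t _; rewrite -Cmod_norm.
  change (Cmod (phi t - Ci * c) <= e / 2)%R.
  have -> : phi t - Ci * c = Ci * ((z t - s0) * f (z t) - c).
    rewrite zE /phi; ring.
  rewrite Cmod_mult.
  have -> : Cmod Ci = 1%R.
    by rewrite /Cmod /= !Rmult_0_l Rplus_0_l !Rmult_1_l sqrt_1.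
  by rewrite Rmult_1_l; left; have [] := Hd _ (zn t) (zd t).
have n0 : 2 * PI * Ci <> 0.
  move=> /(f_equal Im) /=; lra.
have -> : circle_integral f s0 rho / (2 * PI * Ci) - c
  = (circle_integral f s0 rho - 2 * PI * Ci * c) / (2 * PI * Ci).
  by move: n0; set w := 2 * PI * Ci => w0; field.
have cm : Cmod (2 * PI * Ci) = (2 * PI)%R.
  rewrite -RtoC_mult Cmod_mult Cmod_R Rabs_right; last lra.
  have -> : Cmod Ci = 1%R.
    by rewrite /Cmod /= !Rmult_0_l Rplus_0_l !Rmult_1_l sqrt_1.
  ring.
rewrite Cmod_div // cm.
apply: (Rmult_lt_reg_r (2 * PI)); first lra.
have -> : (Cmod (circle_integral f s0 rho - 2 * PI * Ci * c) / (2 * PI) * (2 * PI))%R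
  = Cmod (circle_integral f s0 rho - 2 * PI * Ci * c) by field; lra.
nra.
Qed.

(** * Products of factors close to one *)

Lemma Cmod_le_ReIm (z : C) : (Cmod z <= Rabs (Re z) + Rabs (Im z))%R.
Proof.
have -> : (Rabs (Re z) + Rabs (Im z) = Cmod (RtoC (Re z)) + Cmod (Ci * RtoC (Im z)))%R.
  rewrite Cmod_mult !Cmod_R /Cmod /= !Rmult_0_l Rplus_0_l !Rmult_1_l sqrt_1; ring.
apply: Rle_trans (Cmod_triangle _ _); right; congr Cmod.
by case: z => x y; rewrite /RtoC /Ci /Cmult /Cplus /=; f_equal; ring.
Qed.

Lemma im_le_Cmod (z : C) : (Rabs (Im z) <= Cmod z)%R.
Proof. exact: Rle_trans (Rmax_r _ _) (Rmax_Cmod z). Qed.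

(** The canonical factor of genus two is one up to third order: the derivative
    of [t |-> (1 + t w) exp (- t w + (t w)^2 / 2)] is
    [t^2 w^3 exp (- t w + (t w)^2 / 2)]. *)
Lemma genus2_factor_bound (w : C) : (Cmod w <= 1)%R ->
  (Cmod ((1 + w) * Cexp (- w + w ^ 2 / 2) - 1) <= 2 * exp 2 * Cmod w ^ 3)%R.
Proof.
move=> w1; have w0 := Cmod_ge_0 w.
case E : w => [x y]; rewrite -E.
pose A t := (- t * x + t * t * ((x * x - y * y) / 2))%R.
pose B t := (- t * y + t * t * (x * y))%R.
pose u t := (exp (A t) * ((1 + t * x) * cos (B t) - t * y * sin (B t)))%R.
pose v t := (exp (A t) * ((1 + t * x) * sin (B t) + t * y * cos (B t)))%R.
pose d t : C := (t * t)%R * (w * w * w * Cexp (A t, B t)).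
have x1 : (Rabs x <= 1)%R by apply: Rle_trans w1; rewrite E; apply: (re_le_Cmod (x, y)).
have bound t : (Rabs (t - 0) <= Rabs (1 - 0))%R -> (Cmod (d t) <= exp 2 * Cmod w ^ 3)%R.
  rewrite !Rminus_0_r Rabs_R1 => t1.
  have {t1} [t1 t2] : (-1 <= t /\ t <= 1)%R by split; move: t1; rewrite /Rabs; case: Rcase_abs; lra.
  have x2 : (-1 <= x /\ x <= 1)%R by split; move: x1; rewrite /Rabs; case: Rcase_abs; lra.
  have tt : (0 <= t * t <= 1)%R by nra.
  have xx : (0 <= x * x <= 1)%R by nra.
  have tx : (- t * x <= 1)%R by nra.
  have txx : (t * t * (x * x) <= 1)%R by nra.
  have tyy : (0 <= t * t * (y * y))%R by apply: Rmult_le_pos; nra.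
  have A2 : (A t <= 2)%R by rewrite /A; lra.
  have e2 : (exp (A t) <= exp 2)%R.
    by case: A2 => [/exp_increasing|->]; lra.
  rewrite /d !Cmod_mult Cmod_Cexp Cmod_R /= Rabs_right; last nra.
  have e0 := exp_pos (A t).
  have W : (0 <= Cmod w * (Cmod w * (Cmod w * 1)))%R.
    exact: (pow_le _ 3 w0).
  have -> : (t * t * (Cmod w * Cmod w * Cmod w * exp (A t))
    = (t * t * exp (A t)) * (Cmod w * (Cmod w * (Cmod w * 1))))%R by ring.
  apply: Rmult_le_compat_r => //.
  nra.
have Hu : (Rabs (u 1 - u 0) <= exp 2 * Cmod w ^ 3 * Rabs (1 - 0))%R.
  apply: (bounded_variation u (fun t => Re (d t))) => t Ht; split; last first.
    exact: Rle_trans (re_le_Cmod _) (bound t Ht).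
  rewrite /u /A /B; auto_derive => //.
  rewrite /d /A /B E /=; field.
have Hv : (Rabs (v 1 - v 0) <= exp 2 * Cmod w ^ 3 * Rabs (1 - 0))%R.
  apply: (bounded_variation v (fun t => Im (d t))) => t Ht; split; last first.
    exact: Rle_trans (im_le_Cmod _) (bound t Ht).
  rewrite /v /A /B; auto_derive => //.
  rewrite /d /A /B E /=; field.
rewrite Rminus_0_r Rabs_R1 Rmult_1_r in Hu Hv.
apply: Rle_trans (Cmod_le_ReIm _) _.
have two : w ^ 2 / 2 = ((x * x - y * y) / 2, x * y)%R.
  by rewrite E /Cpow /Cdiv /Cmult /Cinv /=; f_equal; field.
have expE : Cexp (- w + w ^ 2 / 2) = Cexp (A 1, B 1)%R.
  by congr Cexp; rewrite two E /A /B /Cplus /Copp /=; f_equal; ring.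
have u0 : u 0 = 1%R.
  rewrite /u /A /B !(Rmult_0_l, Ropp_0, Rplus_0_l, Rplus_0_r) exp_0 cos_0; ring.
have v0 : v 0 = 0%R.
  rewrite /v /A /B !(Rmult_0_l, Ropp_0, Rplus_0_l, Rplus_0_r) exp_0 sin_0; ring.
have -> : Re ((1 + w) * Cexp (- w + w ^ 2 / 2) - 1) = (u 1 - u 0)%R.
  rewrite expE E u0 /u /=; ring.
have -> : Im ((1 + w) * Cexp (- w + w ^ 2 / 2) - 1) = (v 1 - v 0)%R.
  rewrite expE E v0 /v /=; ring.
lra.
Qed.

(** Distance to one, measured on a scale that turns products into sums. *)
Definition near1 (p : C) (e : R) : Prop := (Cmod (p - 1) <= exp e - 1)%R.

Lemma near1_id (e : R) : (0 <= e)%R -> near1 1 e.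
Proof.
move=> e0; rewrite /near1; have -> : RtoC 1 - 1 = 0 by ring.
rewrite Cmod_0; have := exp_ineq1_le e; lra.
Qed.

Lemma near1_le (p : C) (e : R) : (Cmod (p - 1) <= e)%R -> near1 p e.
Proof. move=> H; have := exp_ineq1_le e; rewrite /near1; lra. Qed.

Lemma near1_mono (p : C) (e f : R) : (e <= f)%R -> near1 p e -> near1 p f.
Proof.
rewrite /near1 => ef H.
have : (exp e <= exp f)%R by case: ef => [/exp_increasing|->]; lra.
lra.
Qed.

Lemma near1_mul (p q : C) (e f : R) : near1 p e -> near1 q f -> near1 (p * q) (e + f).
Proof.
rewrite /near1 exp_plus => Hp Hq.
have -> : p * q - 1 = (p - 1) * (q - 1) + (p - 1) + (q - 1) by ring.
apply: Rle_trans (Cmod_triangle _ _) _.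
apply: Rle_trans (Rplus_le_compat_r _ _ _ (Cmod_triangle _ _)) _.
rewrite Cmod_mult.
have p0 := Cmod_ge_0 (p - 1); have q0 := Cmod_ge_0 (q - 1).
have := Rmult_le_compat _ _ _ _ p0 q0 Hp Hq; lra.
Qed.

Lemma near1_prod (n : nat) (P : pred nat) (f : nat -> C) (e : R) : (0 <= e)%R ->
  (forall i, P i -> near1 (f i) e) -> near1 (\Cprod_(i < n | P i) f i) (INR n * e).
Proof.
move=> e0 H; elim: n => [|n IH].
  by rewrite big_ord0 /= Rmult_0_l; apply: near1_id; lra.
rewrite big_mkcond big_ord_recr -big_mkcond S_INR Rmult_plus_distr_r Rmult_1_l.
apply: near1_mul => //=; case: ifP => [/H //|_]; exact: near1_id.
Qed.

Lemma near1_Cmod (p : C) (e : R) : near1 p e -> (Cmod p <= exp e)%R.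
Proof.
rewrite /near1 => H.
have {1}-> : p = (p - 1) + 1 by ring.
apply: Rle_trans (Cmod_triangle _ _) _; rewrite Cmod_1; lra.
Qed.

(** A sequence of continuous functions that is uniformly Cauchy on an open set
    converges there to a continuous function. *)
Lemma uniform_Cauchy_lim (D : C -> Prop) (f : nat -> C -> C) (eta : nat -> R) :
  (forall z, D z -> locally z D) ->
  (forall n z, cont (f n) z) ->
  (forall e, (0 < e)%R -> exists n, (eta n < e)%R) ->
  (forall z n n', D z -> (n <= n')%N -> (Cmod (f n' z - f n z) <= eta n)%R) ->
  let T z := Clim eventually (fun n => f n z) in
  forall z, D z ->
    [/\ tends eventually (fun n => f n z) (T z),
        forall n, (Cmod (T z - f n z) <= eta n)%R & cont T z].
Proof.
move=> Dopen fc eta0 fCauchy T.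
have Tlim z : D z -> tends eventually (fun n => f n z) (T z).
  move=> Dz.
  have [l Hl] : exists l : C, tends eventually (fun n => f n z) l.
    apply/(@filterlim_locally_cauchy nat C_CompleteNormedModule eventually _ (fun n => f n z)) => e.
    have [n Hn] : exists n, (eta n < e / 2)%R.
      apply: eta0; have := cond_pos e; lra.
    exists (fun k => (n <= k)%N); split; first by exists n => k /leP.
    move=> k k' nk nk'; apply: C_NormedModule_mixin_compat1.
    have -> : minus (f k' z) (f k z) = (f k' z - f n z) + - (f k z - f n z).
      by rewrite /minus /plus /opp /=; ring.
    apply: Rle_lt_trans (Cmod_triangle _ _) _; rewrite Cmod_opp.
    have := fCauchy _ _ _ Dz nk; have := fCauchy _ _ _ Dz nk'; lra.
  by have -> : T z = l by apply: Clim_eq.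
have Tbound z n : D z -> (Cmod (T z - f n z) <= eta n)%R.
  move=> Dz; apply: Rnot_lt_le => H.
  have e0 : (0 < Cmod (T z - f n z) - eta n)%R by lra.
  have /tendsP /(_ _ e0) [N HN] := Tlim z Dz.
  have H1 := HN _ (leP (leq_maxl N n)).
  have H2 := fCauchy _ _ _ Dz (leq_maxr N n).
  have : (Cmod (T z - f n z) <= Cmod (f (maxn N n) z - f n z) + Cmod (f (maxn N n) z - T z))%R.
    rewrite -(Cmod_opp (f (maxn N n) z - T z)).
    apply: Rle_trans (Cmod_triangle _ _); right; congr Cmod; ring.
  lra.
move=> z Dz; split=> [||]; [exact: Tlim | by move=> n; apply: Tbound|].
apply/tendsP => e e0.
have [n Hn] : exists n, (eta n < e / 3)%R by apply: eta0; lra.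
have e3 : (0 < e / 3)%R by lra.
have /tendsP /(_ _ e3) fn := fc n z.
apply: (filterS (filter_and _ _ (Dopen z Dz) fn)) => y [Dy Hy].
have -> : T y - T z = (T y - f n y) + (f n y - f n z) + - (T z - f n z) by ring.
apply: Rle_lt_trans (Cmod_triangle _ _) _; rewrite Cmod_opp.
apply: Rle_lt_trans (Rplus_le_compat_r _ _ _ (Cmod_triangle _ _)) _.
have := Tbound y n Dy; have := Tbound z n Dz; lra.
Qed.

(** * Local structure of the double gamma function *)

(** The points [k tau + l]: [G] vanishes exactly at their opposites. *)
Definition lam (tau : R) (k l : nat) : C := INR k * tau + INR l.

(** The factor of the Barnes product attached to [lam tau k l]. *)
Definition barnes_factor (tau : R) (k l : nat) (z : C) : C :=
  (1 + z / lam tau k l) * Cexp (- (z / lam tau k l) + z ^ 2 / (2 * lam tau k l ^ 2)).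

(** Partial product over the square of side [M]. *)
Definition barnes_part (tau : R) (M : nat) (z : C) : C :=
  \Cprod_(k < M) \Cprod_(l < M | (0 < k + l)%N) barnes_factor tau k l z.

(** Quotient of the partial products over the squares of sides [M + 1] and [M],
    for [M >= 1]. *)
Definition barnes_shell (tau : R) (M : nat) (z : C) : C :=
  \Cprod_(k < M) barnes_factor tau k M z * \Cprod_(l < M.+1) barnes_factor tau M l z.

(** Product of [n] consecutive shells, starting with the shell [M]. *)
Definition barnes_tail (tau : R) (M n : nat) (z : C) : C :=
  \Cprod_(i < n) barnes_shell tau (M + i) z.

Lemma lamE (tau : R) (k l : nat) : lam tau k l = RtoC (INR k * tau + INR l).
Proof. by rewrite /lam RtoC_plus RtoC_mult. Qed.

Lemma barnes_part_S (tau : R) (M : nat) (z : C) : (0 < M)%N ->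
  barnes_part tau M.+1 z = barnes_part tau M z * barnes_shell tau M z.
Proof.
move=> M0; rewrite /barnes_part /barnes_shell big_ord_recr /=.
under eq_bigr => k _.
  rewrite big_mkcond big_ord_recr -big_mkcond /=.
  have -> : (0 < k + M)%N by rewrite addn_gt0 M0 orbT.
  over.
rewrite big_split /= Cmult_assoc; congr (_ * _).
by apply: eq_bigl => l; rewrite addn_gt0 M0.
Qed.

Lemma barnes_part_tail (tau : R) (M n : nat) (z : C) : (0 < M)%N ->
  barnes_part tau (M + n) z = barnes_part tau M z * barnes_tail tau M n z.
Proof.
move=> M0; rewrite /barnes_tail; elim: n => [|n IH].
  by rewrite big_ord0 addn0 Cmult_1_r.
by rewrite addnS barnes_part_S ?addn_gt0 ?M0 // IH big_ord_recr /= Cmult_assoc.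
Qed.

Lemma barnes_tail_add (tau : R) (M n n' : nat) (z : C) :
  barnes_tail tau M (n + n') z = barnes_tail tau M n z * barnes_tail tau (M + n) n' z.
Proof.
rewrite /barnes_tail big_split_ord /=; congr (_ * _).
by apply: eq_bigr => i _; rewrite addnA.
Qed.

Lemma cont_id (z : C) : cont (fun s => s) z.
Proof. exact: filterlim_id. Qed.

Lemma barnes_factor_cont (tau : R) (k l : nat) (z : C) : cont (barnes_factor tau k l) z.
Proof.
have H : cont (fun s => s / lam tau k l) z.
  by apply: tends_mul (@cont_id z) (tends_const _).
apply: tends_mul; first exact: tends_add (tends_const 1) H.
apply: tends_Cexp; apply: tends_add; first exact: tends_opp.
apply: tends_mul (tends_const _).
apply: tends_mul (@cont_id z) _; apply: tends_mul (@cont_id z) (tends_const _).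
Qed.

Lemma barnes_tail_cont (tau : R) (M n : nat) (z : C) : cont (barnes_tail tau M n) z.
Proof.
apply: tends_prod => i _; apply: tends_mul; apply: tends_prod => j _;
  exact: barnes_factor_cont.
Qed.

Lemma Cmod_lam (tau : R) (k l M : nat) : (0 < tau)%R -> (k = M \/ l = M) ->
  (Rmin tau 1 * INR M <= Cmod (lam tau k l))%R.
Proof.
move=> tau0 klM; rewrite lamE Cmod_R; apply: Rle_trans (Rle_abs _).
have m1 := Rmin_l tau 1; have m2 := Rmin_r tau 1.
have k0 := pos_INR k; have l0 := pos_INR l.
by case: klM => <-; nra.
Qed.

Lemma barnes_factor_near1 (tau r : R) (k l M : nat) (z : C) :
  (0 < tau)%R -> (k = M \/ l = M) -> (0 < r)%R -> (r <= Rmin tau 1 * INR M)%R ->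
  (Cmod z <= r)%R ->
  near1 (barnes_factor tau k l z) (2 * exp 2 * (r / (Rmin tau 1 * INR M)) ^ 3).
Proof.
move=> tau0 klM r0 rM zr; apply: near1_le.
have lamM := Cmod_lam tau0 klM.
have L0 : (0 < Cmod (lam tau k l))%R by lra.
have n0 : lam tau k l <> 0 by apply/Cmod_gt_0.
rewrite /barnes_factor; set w := z / lam tau k l.
have wE : Cmod w = (Cmod z / Cmod (lam tau k l))%R by rewrite /w Cmod_div.
have wr : (Cmod w <= r / (Rmin tau 1 * INR M))%R.
  rewrite wE; apply: Rmult_le_compat => //; first exact: Cmod_ge_0.
    by left; apply: Rinv_0_lt_compat.
  by apply: Rinv_le_contravar; lra.
have w1 : (Cmod w <= 1)%R.
  apply: Rle_trans wr _; move: rM; set s := (_ * _)%R => rs.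
  apply: (Rmult_le_reg_r s); first lra.
  have -> : (r / s * s = r)%R by field; lra.
  lra.
have -> : z ^ 2 / (2 * lam tau k l ^ 2) = w ^ 2 / 2.
  by rewrite /w /Cpow; field.
apply: Rle_trans (genus2_factor_bound w1) _.
apply: Rmult_le_compat_l; first by have := exp_pos 2; lra.
by apply: pow_incr; split => //; apply: Cmod_ge_0.
Qed.

(** On the shell of index [M] there are [2 M + 1] factors, each at distance
    [O(1 / M^3)] from one; the bound is written as a telescoping difference. *)
Lemma barnes_shell_near1 (tau r : R) : (0 < tau)%R -> (0 < r)%R ->
  exists2 B : R, (0 < B)%R &
  exists2 M0 : nat, (0 < M0)%N &
  forall M z, (M0 <= M)%N -> (Cmod z <= r)%R ->
    near1 (barnes_shell tau M z) (B * (/ INR M - / INR M.+1)).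
Proof.
move=> tau0 r0; set c := Rmin tau 1.
have c0 : (0 < c)%R by apply: Rmin_glb_lt; lra.
have e0 := exp_pos 2.
set K := (2 * exp 2 * (r / c) ^ 3)%R.
have K0 : (0 < K)%R.
  apply: Rmult_lt_0_compat; first lra.
  by apply: pow_lt; apply: Rdiv_lt_0_compat.
exists (6 * K)%R; first lra.
(* From [M0] on, the lattice points of the shell have modulus at least [r]. *)
have [M0 HM0] := INR_archimed 1 (r / c) Rlt_0_1.
exists M0.+1 => // M z MM0 zr.
have M1 : (1 <= INR M)%R by apply: (le_INR 1); lia.
have rM : (r <= c * INR M)%R.
  have : (INR M0 <= INR M)%R by apply: le_INR; lia.
  move=> H; have H2 : (r / c <= INR M)%R by lra.
  have := Rmult_le_compat_l _ _ _ (Rlt_le _ _ c0) H2.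
  by have -> : (c * (r / c) = r)%R by field; lra.
pose e := (2 * exp 2 * (r / (c * INR M)) ^ 3)%R.
have eE : e = (K / INR M ^ 3)%R by rewrite /e /K; field; lra.
have M3 : (0 < INR M ^ 3)%R by apply: pow_lt; lra.
have e1 : (0 <= e)%R by rewrite eE; left; apply: Rdiv_lt_0_compat.
apply: (@near1_mono _ (INR M * e + INR M.+1 * e)); last first.
  apply: near1_mul.
    apply: (@near1_prod M xpredT (fun k => barnes_factor tau k M z) e) => // k _.
    by apply: barnes_factor_near1 => //; right.
  apply: (@near1_prod M.+1 xpredT (fun l => barnes_factor tau M l z) e) => // l _.
  by apply: barnes_factor_near1 => //; left.
rewrite eE S_INR.
apply: (Rmult_le_reg_r (INR M ^ 3 * (INR M + 1))); first by apply: Rmult_lt_0_compat; lra.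
have -> : ((INR M * (K / INR M ^ 3) + (INR M + 1) * (K / INR M ^ 3)) *
   (INR M ^ 3 * (INR M + 1)) = K * (2 * INR M + 1) * (INR M + 1))%R by field; lra.
have -> : (6 * K * (/ INR M - / (INR M + 1)) * (INR M ^ 3 * (INR M + 1)) =
   K * (6 * INR M * INR M))%R by field; lra.
rewrite Rmult_assoc; apply: Rmult_le_compat_l; first lra.
nra.
Qed.

Lemma barnes_tail_near1 (tau r B : R) (M0 : nat) :
  (forall M z, (M0 <= M)%N -> (Cmod z <= r)%R ->
    near1 (barnes_shell tau M z) (B * (/ INR M - / INR M.+1))) ->
  forall M n z, (M0 <= M)%N -> (Cmod z <= r)%R ->
    near1 (barnes_tail tau M n z) (B * (/ INR M - / INR (M + n)%N)).
Proof.
move=> H M n z MM0 zr; rewrite /barnes_tail; elim: n => [|n IH].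
  by rewrite big_ord0 addn0; apply: near1_id; right; ring.
rewrite big_ord_recr addnS.
have -> : (B * (/ INR M - / INR (M + n).+1) = B * (/ INR M - / INR (M + n)%N)
  + B * (/ INR (M + n)%N - / INR (M + n).+1))%R by ring.
apply: near1_mul => //; apply: H => //; exact: leq_trans (leq_addr _ _).
Qed.

(** The bound on the tails of the product tends to zero. *)
Lemma tail_bound_lim (B e : R) : (0 < B)%R -> (0 < e)%R ->
  exists N, forall n, (N <= n)%N -> (exp (B / INR n) - 1 < e)%R.
Proof.
move=> B0 e0.
have l0 : (0 < ln (1 + e))%R by rewrite -ln_1; apply: ln_increasing; lra.
have [N HN] := INR_archimed (ln (1 + e)) B l0.
exists N.+1 => n Nn.
have : (INR N.+1 <= INR n)%R by apply: le_INR; lia.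
rewrite S_INR => H; have N0 := pos_INR N.
have : (exp (B / INR n) < exp (ln (1 + e)))%R.
  apply: exp_increasing; apply: (Rmult_lt_reg_r (INR n)); first lra.
  have -> : (B / INR n * INR n = B)%R by field; lra.
  nra.
rewrite exp_ln; lra.
Qed.

(** On a disc the product is a partial product times a continuous function
    without zeros, and the partial product may be taken as large as desired. *)
Lemma barnes_product_local (tau r : R) (M1 : nat) : (0 < tau)%R -> (0 < r)%R ->
  exists M, exists T : C -> C, (M1 <= M)%N /\
  forall z, (Cmod z < r)%R ->
    [/\ T z <> 0, cont T z & barnes_product tau z = barnes_part tau M z * T z].
Proof.
move=> tau0 r0.
have [B B0 [M0 M00 shell]] := barnes_shell_near1 tau0 r0.
have tail := barnes_tail_near1 shell.
(* With tails below 1/4 the limit [T] stays at distance less than one from one. *)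
have [N HN] := tail_bound_lim B0 (ltac:(lra) : (0 < / 4)%R).
pose M := (M1 + M0 + N)%N.
have HM := HN M (leq_addl _ _).
have M0M : (M0 <= M)%N by rewrite /M; lia.
have Mpos : (0 < M)%N by lia.
have inr_pos k : (0 < INR (M + k)%N)%R by apply: (lt_INR 0); lia.
have tailM k n z : (Cmod z <= r)%R ->
    near1 (barnes_tail tau (M + k) n z) (B / INR (M + k)%N).
  move=> zr; apply: near1_mono (tail _ n z (leq_trans M0M (leq_addr k M)) zr).
  have := Rinv_0_lt_compat _ (inr_pos (k + n)%N); rewrite addnA => H; nra.
pose eta n := (2 * (exp (B / INR (M + n)%N) - 1))%R.
have Dopen z : (Cmod z < r)%R -> locally z (fun z => (Cmod z < r)%R).
  move=> zr; apply/locally_CmodP; exists (r - Cmod z)%R => [|y Hy]; first lra.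
  have -> : y = (y - z) + z by ring.
  have := Cmod_triangle (y - z) z; lra.
have eta0 e : (0 < e)%R -> exists n, (eta n < e)%R.
  move=> e0; have [n Hn] := tail_bound_lim B0 (ltac:(lra) : (0 < e / 2)%R).
  by exists n; have := Hn _ (leq_addl M n); rewrite /eta; lra.
have fCauchy z n n' : (Cmod z < r)%R -> (n <= n')%N ->
    (Cmod (barnes_tail tau M n' z - barnes_tail tau M n z) <= eta n)%R.
  move=> zr nn'; rewrite -(subnKC nn') barnes_tail_add.
  set p := barnes_tail tau M n z; set q := barnes_tail _ _ _ _.
  have -> : p * q - p = p * (q - 1) by ring.
  rewrite Cmod_mult /eta.
  have Hp := near1_Cmod (tailM 0%N n z (Rlt_le _ _ zr)); rewrite addn0 -/p in Hp.
  have Hq := tailM n (n' - n)%N z (Rlt_le _ _ zr); rewrite /near1 -/q in Hq.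
  apply: Rmult_le_compat => //; try exact: Cmod_ge_0.
  lra.
have U := uniform_Cauchy_lim Dopen (fun n z => @barnes_tail_cont tau M n z) eta0 fCauchy.
set T := fun z => _ in U.
exists M, T; split; first by rewrite /M; lia.
move=> z zr; have [Tlim Tb Tc] := U z zr; split => //.
  move=> T0; have := Tb 0%N; rewrite T0 /eta addn0 /barnes_tail big_ord0.
  have -> : 0 - 1 = - RtoC 1 by ring.
  rewrite Cmod_opp Cmod_1; lra.
apply: Clim_eq.
have Plim : tends eventually (fun n => barnes_part tau M z * barnes_tail tau M n z)
    (barnes_part tau M z * T z) by apply: tends_mul (tends_const _) Tlim.
apply/tendsP => e e0; have /tendsP /(_ e e0) [n Hn] := Plim.
exists (M + n)%N => k /leP Mk.
have Mk' : (M <= k)%N by lia.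
have := Hn (k - M)%N; rewrite -barnes_part_tail // subnKC //; apply.
apply/leP; lia.
Qed.

Lemma Cprod_neq0 (I : Type) (r : seq I) (P : pred I) (f : I -> C) :
  (forall i, P i -> f i <> 0) -> \big[Cmult/RtoC 1]_(i <- r | P i) f i <> 0.
Proof.
move=> H; elim/big_ind: _ => //; last exact: Cmult_neq_0.
by move=> /(f_equal (@fst R R)) /=; lra.
Qed.

(** The linear factors of [G] coming from a square of lattice points. *)
Definition lam_prod (tau : R) (M : nat) (z : C) : C :=
  \big[Cmult/RtoC 1]_(x : 'I_M * 'I_M) (z + lam tau x.1 x.2).

Lemma lam_neq0 (tau : R) (k l : nat) : (0 < tau)%R -> (0 < k + l)%N -> lam tau k l <> 0.
Proof.
move=> tau0 kl; rewrite lamE => /RtoC_inj.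
have k0 := pos_INR k; have l0 := pos_INR l.
case: k kl k0 => [|k]; last by rewrite S_INR; have := pos_INR k; nra.
rewrite add0n => /ltP /(lt_INR 0) /=; nra.
Qed.

(** The factor [z] of [G] accounts for the missing pair [(0, 0)]. *)
Lemma lam_prod_barnes_part (tau : R) (M : nat) : (0 < tau)%R -> (0 < M)%N ->
  exists W : C -> C, forall z,
    [/\ W z <> 0, cont W z & z * barnes_part tau M z = lam_prod tau M z * W z].
Proof.
move=> tau0; case: M => // M _.
pose h (x : 'I_M.+1 * 'I_M.+1) z : C :=
  / lam tau x.1 x.2 *
  Cexp (- (z / lam tau x.1 x.2) + z ^ 2 / (2 * lam tau x.1 x.2 ^ 2)).
have lam0 (x : 'I_M.+1 * 'I_M.+1) : x != (ord0, ord0) -> lam tau x.1 x.2 <> 0.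
  case: x => k l kl; apply: lam_neq0 => //=; move: kl.
  apply: contraR; rewrite -eqn0Ngt addn_eq0 => /andP [/eqP k0 /eqP l0].
  by apply/eqP; congr pair; apply: val_inj.
exists (fun z => \big[Cmult/RtoC 1]_(x | x != (ord0, ord0)) h x z) => z; split.
- apply: Cprod_neq0 => x /lam0 x0; apply: Cmult_neq_0; last exact: Cexp_neq0.
  by move=> E; apply: C1_nz; rewrite -(Cinv_l _ x0) E; ring.
- apply: tends_prod => x _; apply: tends_mul (tends_const _) _.
  apply: tends_Cexp; apply: tends_add.
    by apply: tends_opp; apply: tends_mul (@cont_id z) (tends_const _).
  apply: tends_mul (tends_const _).
  by apply: tends_mul (@cont_id z) _; apply: tends_mul (@cont_id z) (tends_const _).
rewrite /lam_prod (bigD1 (ord0, ord0)) //= /barnes_part.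
have -> : z + lam tau 0 0 = z by rewrite lamE /= Rmult_0_l Rplus_0_l; ring.
rewrite -Cmult_assoc -big_split /= pair_big_dep /=; congr (_ * _).
apply: eq_big => [[k l]|[k l] kl].
  by rewrite lt0n addn_eq0 negb_and.
rewrite /barnes_factor /h /= ; field.
by apply: lam_neq0.
Qed.

(** On each disc the double gamma function is a finite product of linear
    factors times a continuous function without zeros. *)
Lemma double_gamma_local (tau : R) (G : C -> C) (r : R) (M1 : nat) :
  (0 < tau)%R -> is_double_gamma tau G -> (0 < r)%R ->
  exists M, exists U : C -> C, (M1 <= M)%N /\
  forall z, (Cmod z < r)%R ->
    [/\ U z <> 0, cont U z & G z = lam_prod tau M z * U z].
Proof.
move=> tau0 [c1 [c2 [GE _ _]]] r0.
have tn0 : RtoC tau <> 0 by move=> /RtoC_inj; lra.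
have [M [T [M1M HT]]] := barnes_product_local M1.+1 tau0 r0.
have [W HW] := lam_prod_barnes_part tau0 (leq_ltn_trans (leq0n _) M1M).
exists M, (fun z => Cexp (c1 * z / tau + c2 * z ^ 2 / (2 * tau ^ 2)) / tau * (W z * T z)).
split; first exact: ltnW.
move=> z /HT [T0 Tc TE]; have [W0 Wc WE] := HW z; split.
- apply: Cmult_neq_0; last exact: Cmult_neq_0.
  apply: Cmult_neq_0; first exact: Cexp_neq0.
  by move=> E; apply: C1_nz; rewrite -(Cinv_l _ tn0) E; ring.
- apply: tends_mul; last exact: tends_mul.
  apply: tends_mul (tends_const _).
  apply: tends_Cexp; apply: tends_add; apply: tends_mul (tends_const _).
    exact: tends_mul (tends_const _) (@cont_id z).
  apply: tends_mul (tends_const _) _.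
  by apply: tends_mul (@cont_id z) _; apply: tends_mul (@cont_id z) (tends_const _).
rewrite GE TE.
have -> : lam_prod tau M z * (Cexp (c1 * z / tau + c2 * z ^ 2 / (2 * tau ^ 2)) / tau *
   (W z * T z)) = (lam_prod tau M z * W z) *
   (Cexp (c1 * z / tau + c2 * z ^ 2 / (2 * tau ^ 2)) / tau * T z) by ring.
rewrite -WE /Cdiv; ring.
Qed.

Lemma Cplus_eq0 (x y : C) : x + y = 0 -> x = - y.
Proof. by move=> E; transitivity (x + y - y); [ring | rewrite E; ring]. Qed.

Section DoubleGamma.
Variables (tau : R) (G : C -> C).
Hypotheses (tau_gt0 : (0 < tau)%R) (dgG : is_double_gamma tau G).

Lemma lam_prod_cont (M : nat) (z : C) : cont (lam_prod tau M) z.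
Proof.
by apply: tends_prod => x _; apply: tends_add (@cont_id z) (tends_const _).
Qed.

Lemma double_gamma_cont (z : C) : cont G z.
Proof.
have r0 : (0 < Cmod z + 1)%R by have := Cmod_ge_0 z; lra.
have [M [U [_ HU]]] := double_gamma_local 0 tau_gt0 dgG r0.
have [_ Uc UE] := HU z (ltac:(lra)).
rewrite /cont UE.
apply: (tends_ext_loc (tends_mul (@lam_prod_cont M z) Uc)).
apply/locally_CmodP; exists 1%R => [|y yz]; first lra.
have [] // := HU y _.
have -> : y = (y - z) + z by ring.
have := Cmod_triangle (y - z) z; lra.
Qed.

Lemma double_gamma_zero (k l : nat) : G (- lam tau k l) = 0.
Proof.
set z := - _; have r0 : (0 < Cmod z + 1)%R by have := Cmod_ge_0 z; lra.
have [M [U [kM HU]]] := double_gamma_local (k + l).+1 tau_gt0 dgG r0.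
have [_ Uc ->] := HU z (ltac:(lra)).
have kM' : (k < M)%N by lia.
have lM' : (l < M)%N by lia.
rewrite /lam_prod (bigD1 (Ordinal kM', Ordinal lM')) //= /z; ring.
Qed.

Lemma double_gamma_neq0 (z : C) : (forall k l, z <> - lam tau k l) -> G z <> 0.
Proof.
move=> zn; have r0 : (0 < Cmod z + 1)%R by have := Cmod_ge_0 z; lra.
have [M [U [_ HU]]] := double_gamma_local 0 tau_gt0 dgG r0.
have [U0 Uc ->] := HU z (ltac:(lra)).
apply: Cmult_neq_0 => //; apply: Cprod_neq0 => x _ E.
apply: (zn x.1 x.2).
have -> : z = (z + lam tau x.1 x.2) - lam tau x.1 x.2 by ring.
rewrite E; ring.
Qed.

Lemma lam_inj (k l k' l' : nat) : (forall r : Q, tau <> Q2R r) ->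
  lam tau k l = lam tau k' l' -> k = k' /\ l = l'.
Proof.
move=> irr; rewrite !lamE => /RtoC_inj E.
have [kk|kk] : k = k' \/ k <> k' by lia.
  split => //; apply: INR_eq; move: E; rewrite kk; lra.
(* If [k <> k'] then [tau] is the rational number [(l' - l) / (k - k')]. *)
case: (irr (inject_Z (Z.of_nat l' - Z.of_nat l) / inject_Z (Z.of_nat k - Z.of_nat k'))%Q).
have Q2RZ x : Q2R (inject_Z x) = IZR x by rewrite /Q2R /=; field.
have kz : IZR (Z.of_nat k - Z.of_nat k') <> 0%R by apply: not_0_IZR; lia.
rewrite Qreals.Q2R_div; last by move=> H; apply: kz; rewrite -Q2RZ H /Q2R /=; field.
rewrite !Q2RZ; apply: (Rmult_eq_reg_r _ _ _ _ kz).
rewrite /Rdiv Rmult_assoc Rinv_l // !minus_IZR -!INR_IZR_INZ; lra.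
Qed.

(** For irrational [tau] the zeros of [G] are simple. *)
Lemma double_gamma_simple_zero (k l : nat) : (forall r : Q, tau <> Q2R r) ->
  exists R : C -> C, [/\ R (- lam tau k l) <> 0, cont R (- lam tau k l)
    & locally (- lam tau k l) (fun z => G z = (z + lam tau k l) * R z)].
Proof.
move=> irr; set z := - _.
have r0 : (0 < Cmod z + 1)%R by have := Cmod_ge_0 z; lra.
have [M [U [kM HU]]] := double_gamma_local (k + l).+1 tau_gt0 dgG r0.
have kM' : (k < M)%N by lia.
have lM' : (l < M)%N by lia.
pose x0 := (Ordinal kM', Ordinal lM').
have [U0 Uc _] := HU z (ltac:(lra)).
exists (fun s => \big[Cmult/RtoC 1]_(x | x != x0) (s + lam tau x.1 x.2) * U s); split.
- apply: Cmult_neq_0 => //; apply: Cprod_neq0 => -[k' l'] /= xx0 E.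
  have [kk ll] : nat_of_ord k' = k /\ nat_of_ord l' = l.
    apply: lam_inj => //.
    have -> : lam tau k' l' = (z + lam tau k' l') + lam tau k l by rewrite /z; ring.
    rewrite E; ring.
  by case/negP: xx0; rewrite xpair_eqE -!val_eqE /= kk ll !eqxx.
- apply: tends_mul => //; apply: tends_prod => x _.
  exact: tends_add (@cont_id z) (tends_const _).
apply/locally_CmodP; exists 1%R => [|y yz]; first lra.
have [|_ _ ->] := HU y.
  have -> : y = (y - z) + z by ring.
  have := Cmod_triangle (y - z) z; lra.
by rewrite /lam_prod (bigD1 x0) //= Cmult_assoc.
Qed.

(** The zeros of [G] are isolated. *)
Lemma double_gamma_punctured_neq0 (z : C) : (forall r : Q, tau <> Q2R r) ->
  locally' z (fun s => G s <> 0).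
Proof.
move=> irr; case: (classic (exists k l, z = - lam tau k l)) => [[k [l ->]]|zn].
  have [R [R0 Rc RE]] := double_gamma_simple_zero k l irr.
  have R1 : locally (- lam tau k l) (fun s => R s <> 0) by apply: tends_neq0 R0 Rc.
  rewrite /locally' /within.
  apply: (filterS (filter_and _ _ R1 RE)) => s [Rs ->] sz.
  apply: Cmult_neq_0 => // E; apply: sz.
  exact: Cplus_eq0.
have Gz : G z <> 0.
  by apply: double_gamma_neq0 => k l E; apply: zn; exists k, l.
by apply: tends_neq0 Gz (tends_locally' (@double_gamma_cont z)).
Qed.

Lemma in_lattice_lam (k l : nat) : in_lattice tau (- lam tau k l).
Proof.
exists (- Z.of_nat l)%Z, (- Z.of_nat k)%Z.
rewrite !opp_IZR -!INR_IZR_INZ /lam !RtoC_opp; ring.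
Qed.

Lemma double_gamma_neq0_lattice (z : C) : ~ in_lattice tau z -> G z <> 0.
Proof.
by move=> zl; apply: double_gamma_neq0 => k l E; apply: zl; rewrite E; apply: in_lattice_lam.
Qed.

(** Where [G] does not vanish its functional equations hold without further
    restriction, because the poles of the Gamma factor are zeros of [G]. *)
Lemma double_gamma_shift1 (z : C) : G z <> 0 -> G (z + 1) = CGamma (z / tau) * G z.
Proof.
have [c1 [c2 [_ H _]]] := dgG.
have tn0 : RtoC tau <> 0 by move=> /RtoC_inj; lra.
move=> Gz; apply: H => -[k E]; apply: Gz.
have -> : z = - lam tau k 0.
  have -> : z = z / tau * tau by field.
  by rewrite E /lam /=; ring.
exact: double_gamma_zero.
Qed.

Lemma double_gamma_shift_tau (z : C) : G z <> 0 ->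
  G (z + tau) = Rcpow (2 * PI) ((tau - 1) / 2) * Rcpow tau (1 / 2 - z) * CGamma z * G z.
Proof.
have [c1 [c2 [_ _ H]]] := dgG.
move=> Gz; apply: H => -[k E]; apply: Gz.
have -> : z = - lam tau 0 k by rewrite E /lam /=; ring.
exact: double_gamma_zero.
Qed.

End DoubleGamma.

(** * Functional equations of the quotient *)

Lemma Rcpow_neq0 (x : R) (w : C) : Rcpow x w <> 0.
Proof. exact: Cexp_neq0. Qed.

Lemma Rcpow_add (x : R) (v w : C) : Rcpow x (v + w) = Rcpow x v * Rcpow x w.
Proof. by rewrite /Rcpow -Cexp_add; congr Cexp; ring. Qed.

Lemma Rcpow_sum (x : R) (I : Type) (r : seq I) (P : pred I) (f : I -> C) :
  \big[Cmult/RtoC 1]_(i <- r | P i) Rcpow x (f i) =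
  Rcpow x (\big[Cplus/RtoC 0]_(i <- r | P i) f i).
Proof.
elim: r => [|i r IH].
  by rewrite !big_nil /Rcpow Cmult_0_l Cexp_0.
by rewrite !big_cons; case: ifP => // _; rewrite IH Rcpow_add.
Qed.

Lemma Csum_affine (I : Type) (r : seq I) (P : pred I) (c e : C) (f : I -> C) :
  \big[Cplus/RtoC 0]_(i <- r | P i) (c + e * f i) =
  \big[Cplus/RtoC 0]_(i <- r | P i) c + e * \big[Cplus/RtoC 0]_(i <- r | P i) f i.
Proof.
elim: r => [|i r IH]; first by rewrite !big_nil; ring.
by rewrite !big_cons; case: ifP => // _; rewrite IH; ring.
Qed.

Lemma Csum_const_lt (n m : nat) (c : C) : (m <= n)%N ->
  \Csum_(j < n | (j < m)%N) c = INR m * c.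
Proof.
move=> mn; rewrite -(big_ord_widen n (fun=> c) mn).
elim: m {mn} => [|m IH]; first by rewrite big_ord0 /=; ring.
by rewrite big_ord_recr IH S_INR RtoC_plus /=; ring.
Qed.

Lemma Csum_const_ge (n m : nat) (c : C) : (m <= n)%N ->
  \Csum_(j < n | (m <= j)%N) c = (INR n - INR m) * c.
Proof.
move=> mn.
have : \Csum_(j < n | (j < n)%N) c =
    \Csum_(j < n | (j < m)%N) c + \Csum_(j < n | (m <= j)%N) c.
  rewrite (bigID (fun j : 'I_n => (j < m)%N)) /=; congr (_ + _).
    by apply: eq_bigl => j; rewrite ltn_ord.
  by apply: eq_bigl => j; rewrite ltn_ord -leqNgt.
rewrite !Csum_const_lt // => E.
transitivity ((INR m * c + \Csum_(j < n | (m <= j)%N) c) - INR m * c); first ring.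
by rewrite -E; ring.
Qed.

(** Shifting the argument in a quotient whose four families of factors are
    multiplied or divided by [k_i g_i]. *)
Lemma quotient_shift (B1 B1' A1 A1' B2 B2' A2 A2' k1 k2 k3 k4 g1 g2 g3 g4 : C) :
  B1 <> 0 -> B2' <> 0 -> A2 <> 0 ->
  B1 = k1 * g1 * B1' -> A1' = k2 * g2 * A1 ->
  B2' = k3 * g3 * B2 -> A2 = k4 * g4 * A2' ->
  B1' * A1' / (B2' * A2') =
  (k2 * k4 / (k1 * k3)) * ((g2 * g4) / (g1 * g3)) * ((B1 * A1) / (B2 * A2)).
Proof.
move=> nB1 nB2' nA2 E1 -> E3 E4; rewrite E1 E3 E4 in nB1 nB2' nA2 *.
have nz x y z : x * y * z <> 0 -> [/\ x <> 0, y <> 0 & z <> 0].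
  by move=> H; split=> E; apply: H; rewrite E; ring.
have [? ? ?] := nz _ _ _ nB1; have [? ? ?] := nz _ _ _ nB2'.
have [? ? ?] := nz _ _ _ nA2; field; repeat split => //.
Qed.

Lemma filter_forall_ord {T : Type} (D : (T -> Prop) -> Prop) {FD : Filter D}
    (n : nat) (P : 'I_n -> T -> Prop) :
  (forall i, D (P i)) -> D (fun x => forall i, P i x).
Proof.
move=> H; have {}H k : D (fun x => forall i : 'I_n, (i < k)%N -> P i x).
  elim: k => [|k IH]; first by apply: filter_forall.
  case: (ltnP k n) => kn; last first.
    apply: (filterS IH) => x Hx i _; apply: Hx; exact: leq_trans (ltn_ord i) kn.
  apply: (filterS (filter_and _ _ IH (H (Ordinal kn)))) => x [Hx Hk] i.
  rewrite ltnS leq_eqVlt => /orP [/eqP ik|]; last exact: Hx.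
  by have -> : i = Ordinal kn by apply: val_inj.
by apply: (filterS (H n)) => x Hx i; apply: Hx.
Qed.

Section Quotient.
Variables (tau : R) (G : C -> C) (p q m n : nat) (a : 'I_p -> C) (b : 'I_q -> C).
Hypotheses (tau_gt0 : (0 < tau)%R) (dgG : is_double_gamma tau G).
Hypotheses (le_mq : (m <= q)%N) (le_np : (n <= p)%N).
Hypothesis irr : forall r : Q, tau <> Q2R r.

Let g := calG G tau m n a b.
Let F := calF tau m n a b.
Let H := calH tau m n a b.

(** No factor of the quotient vanishes at [s]. *)
Definition factors_neq0 (s : C) : Prop :=
  [/\ forall j, G (b j - s) <> 0, forall j, G (1 + tau - b j + s) <> 0,
      forall j, G (a j - s) <> 0 & forall j, G (1 + tau - a j + s) <> 0].

Lemma tends_affine (u v s0 : C) : cont (fun s => G (u * s + v)) s0.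
Proof.
apply: (@tends_comp _ _ _ (locally (u * s0 + v)) (fun s => u * s + v) G).
  exact: locally_affine.
exact: double_gamma_cont dgG _.
Qed.

Lemma cont_pos_shift (v s0 : C) : cont (fun s => G (v + s)) s0.
Proof.
have := @tends_affine 1 v s0; rewrite /cont.
have E (x : C) : 1 * x + v = v + x by ring.
rewrite E => /tends_ext; apply => x; by rewrite E.
Qed.

Lemma cont_neg_shift (v s0 : C) : cont (fun s => G (v - s)) s0.
Proof.
have := @tends_affine (- RtoC 1) v s0; rewrite /cont.
have E (x : C) : - RtoC 1 * x + v = v - x by ring.
rewrite E => /tends_ext; apply => x; by rewrite E.
Qed.

(** For [u <> 0] the zeros of [G (u s + v)] are isolated. *)
Lemma punctured_affine (u v s0 : C) : u <> 0 ->
  locally' s0 (fun s => G (u * s + v) <> 0).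
Proof.
move=> u0; apply: (@locally'_affine u v s0 u0 (fun z => G z <> 0)).
exact: double_gamma_punctured_neq0 dgG _ irr.
Qed.

(** The points excluded by [factors_neq0] are isolated. *)
Lemma factors_punctured (s0 : C) : locally' s0 factors_neq0.
Proof.
have n1 : - RtoC 1 <> 0 by move=> /(f_equal (@fst R R)) /=; lra.
have neg v : locally' s0 (fun s => G (v - s) <> 0).
  apply: (filterS (punctured_affine v s0 n1)) => s.
  by have -> : - RtoC 1 * s + v = v - s by ring.
have pos v : locally' s0 (fun s => G (v + s) <> 0).
  apply: (filterS (punctured_affine v s0 C1_nz)) => s.
  by have -> : 1 * s + v = v + s by ring.
have H1 : locally' s0 (fun s => forall j, G (b j - s) <> 0).
  by apply: filter_forall_ord => j; apply: neg.
have H2 : locally' s0 (fun s => forall j, G (1 + tau - b j + s) <> 0).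
  by apply: filter_forall_ord => j; apply: pos.
have H3 : locally' s0 (fun s => forall j, G (a j - s) <> 0).
  by apply: filter_forall_ord => j; apply: neg.
have H4 : locally' s0 (fun s => forall j, G (1 + tau - a j + s) <> 0).
  by apply: filter_forall_ord => j; apply: pos.
by apply: (filterS (filter_and _ _ (filter_and _ _ H1 H2) (filter_and _ _ H3 H4))) => s [[]] ? ? [].
Qed.

Lemma factors_punctured_shift (t s0 : C) : locally' s0 (fun s => factors_neq0 (s + t)).
Proof.
have := @locally'_affine 1 t s0 C1_nz _ (factors_punctured (1 * s0 + t)).
rewrite /filtermap => K; apply: (filterS K) => s.
by rewrite Cmult_1_l.
Qed.

Lemma calG_neq0 (s : C) : factors_neq0 s -> g s <> 0.
Proof.
move=> [H1 H2 H3 H4]; apply: Cmult_neq_0; first by apply: Cmult_neq_0; apply: Cprod_neq0.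
have D0 : \Cprod_(j < q | (m <= j)%N) G (1 + tau - b j + s)
     * \Cprod_(j < p | (n <= j)%N) G (a j - s) <> 0.
  by apply: Cmult_neq_0; apply: Cprod_neq0.
by move=> E; apply: C1_nz; rewrite -(Cinv_l _ D0) E; ring.
Qed.

Lemma calG_cont (s : C) : factors_neq0 s -> cont g s.
Proof.
move=> [H1 H2 H3 H4]; apply: tends_div.
- by apply: Cmult_neq_0; apply: Cprod_neq0.
- by apply: tends_mul; apply: tends_prod => j _; [apply: cont_neg_shift | apply: cont_pos_shift].
- by apply: tends_mul; apply: tends_prod => j _; [apply: cont_pos_shift | apply: cont_neg_shift].
Qed.

Lemma calG_shift1 (s : C) : factors_neq0 s -> factors_neq0 (s + 1) ->
  g (s + 1) = F s * g s.
Proof.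
move=> [b1 b2 a1 a2] [b1' b2' a1' a2'].
have tn0 : RtoC tau <> 0 by move=> /RtoC_inj; lra.
have neg c : G (c - (s + 1)) <> 0 ->
    G (c - s) = CGamma ((c - s - 1) / tau) * G (c - (s + 1)).
  move=> /(double_gamma_shift1 tau_gt0 dgG).
  have -> : c - (s + 1) + 1 = c - s by ring.
  by have -> : c - (s + 1) = c - s - 1 by ring.
have pos c : G (1 + tau - c + s) <> 0 ->
    G (1 + tau - c + (s + 1)) = CGamma (1 + (1 - c + s) / tau) * G (1 + tau - c + s).
  move=> /(double_gamma_shift1 tau_gt0 dgG).
  have -> : 1 + tau - c + s + 1 = 1 + tau - c + (s + 1) by ring.
  by have -> : (1 + tau - c + s) / tau = 1 + (1 - c + s) / tau by field.
rewrite /g /calG /F /calF.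
have one : RtoC 1 * 1 / (1 * 1) = 1 by field.
have E (A B X Y : C) : A / B * (X / Y) = (1 * 1 / (1 * 1)) * (A / B) * (X / Y).
  by rewrite one Cmult_1_l.
rewrite [RHS]E; apply: quotient_shift.
- exact: Cprod_neq0.
- exact: Cprod_neq0.
- exact: Cprod_neq0.
- by rewrite Cmult_1_l -big_split; apply: eq_bigr => j _; apply: neg.
- by rewrite Cmult_1_l -big_split; apply: eq_bigr => j _; apply: pos.
- by rewrite Cmult_1_l -big_split; apply: eq_bigr => j _; apply: pos.
- by rewrite Cmult_1_l -big_split; apply: eq_bigr => j _; apply: neg.
Qed.

Lemma calG_shift_tau (s : C) : factors_neq0 s -> factors_neq0 (s + tau) ->
  g (s + tau) = H s * g s.
Proof.
move=> [b1 b2 a1 a2] [b1' b2' a1' a2'].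
pose w : C := (tau - 1) / 2.
pose K e := Rcpow (2 * PI) w * Rcpow tau e.
have neg c : G (c - (s + tau)) <> 0 ->
    G (c - s) = K (1 / 2 + s + tau + (- RtoC 1) * c) * CGamma (c - tau - s)
      * G (c - (s + tau)).
  move=> /(double_gamma_shift_tau tau_gt0 dgG).
  have -> : c - (s + tau) + tau = c - s by ring.
  have -> : 1 / 2 - (c - (s + tau)) = 1 / 2 + s + tau + (- RtoC 1) * c by ring.
  by have -> : c - (s + tau) = c - tau - s by ring.
have pos c : G (1 + tau - c + s) <> 0 ->
    G (1 + tau - c + (s + tau)) = K (- (1 / 2) - tau - s + 1 * c)
      * CGamma (1 + tau - c + s) * G (1 + tau - c + s).
  move=> /(double_gamma_shift_tau tau_gt0 dgG).
  have -> : 1 + tau - c + s + tau = 1 + tau - c + (s + tau) by ring.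
  by have -> : 1 / 2 - (1 + tau - c + s) = - (1 / 2) - tau - s + 1 * c by field.
have prodK (r : nat) (P : pred 'I_r) (c e : C) (f : 'I_r -> C) :
    \Cprod_(j < r | P j) K (c + e * f j) =
    Rcpow (2 * PI) (\Csum_(j < r | P j) w) *
    Rcpow tau (\Csum_(j < r | P j) c + e * \Csum_(j < r | P j) f j).
  by rewrite big_split !Rcpow_sum Csum_affine.
rewrite /g /calG /H /calH.
have -> : Rcpow (2 * PI) ((tau - 1) * (INR p - INR q) / 2)
  * Rcpow tau (calmu m n a b - calN p q m n * (tau + 1 / 2))
  * Rcpow tau (- s * calN p q m n) =
  (\Cprod_(j < p | (j < n)%N) K (- (1 / 2) - tau - s + 1 * a j)
   * \Cprod_(j < p | (n <= j)%N) K (1 / 2 + s + tau + (- RtoC 1) * a j))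
  / (\Cprod_(j < q | (j < m)%N) K (1 / 2 + s + tau + (- RtoC 1) * b j)
   * \Cprod_(j < q | (m <= j)%N) K (- (1 / 2) - tau - s + 1 * b j)).
  rewrite !prodK.
  set X1 := Rcpow (2 * PI) (\Csum_(j < p | (j < n)%N) w).
  set X2 := Rcpow (2 * PI) (\Csum_(j < p | (n <= j)%N) w).
  set X3 := Rcpow (2 * PI) (\Csum_(j < q | (j < m)%N) w).
  set X4 := Rcpow (2 * PI) (\Csum_(j < q | (m <= j)%N) w).
  set Y1 := Rcpow tau (_ + 1 * \Csum_(j < p | (j < n)%N) a j).
  set Y2 := Rcpow tau (_ + _ * \Csum_(j < p | (n <= j)%N) a j).
  set Y3 := Rcpow tau (_ + _ * \Csum_(j < q | (j < m)%N) b j).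
  set Y4 := Rcpow tau (_ + 1 * \Csum_(j < q | (m <= j)%N) b j).
  have n3 : X3 <> 0 by apply: Rcpow_neq0.
  have n4 : X4 <> 0 by apply: Rcpow_neq0.
  have m3 : Y3 <> 0 by apply: Rcpow_neq0.
  have m4 : Y4 <> 0 by apply: Rcpow_neq0.
  have EX : Rcpow (2 * PI) ((tau - 1) * (INR p - INR q) / 2) * (X3 * X4) = X1 * X2.
    rewrite /X1 /X2 /X3 /X4 -!Rcpow_add; congr Rcpow.
    by rewrite !Csum_const_lt // !Csum_const_ge // /w; field.
  have EY : Rcpow tau (calmu m n a b - calN p q m n * (tau + 1 / 2))
      * Rcpow tau (- s * calN p q m n) * (Y3 * Y4) = Y1 * Y2.
    rewrite /Y1 /Y2 /Y3 /Y4 -!Rcpow_add; congr Rcpow.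
    rewrite !Csum_const_lt // !Csum_const_ge // /calmu /calN.
    by rewrite !(RtoC_minus, RtoC_mult, RtoC_plus); field.
  transitivity ((X1 * X2) * (Y1 * Y2) / ((X3 * X4) * (Y3 * Y4))).
    by rewrite -EX -EY; field; repeat split.
  by field; repeat split.
apply: quotient_shift.
- exact: Cprod_neq0.
- exact: Cprod_neq0.
- exact: Cprod_neq0.
- by rewrite -!big_split; apply: eq_bigr => j _; apply: neg.
- by rewrite -!big_split; apply: eq_bigr => j _; apply: pos.
- by rewrite -!big_split; apply: eq_bigr => j _; apply: pos.
- by rewrite -!big_split; apply: eq_bigr => j _; apply: neg.
Qed.

(** * Simple poles and recurrences *)

(** When [N] and [D] are continuous and nonzero at [s0], and [G (u s + v)]
    vanishes there, the quotient has a simple pole at [s0]. *)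
Lemma simple_pole (N D : C -> C) (u v s0 : C) (k l : nat) :
  u <> 0 -> u * s0 + v = - lam tau k l ->
  cont N s0 -> N s0 <> 0 -> cont D s0 -> D s0 <> 0 ->
  exists2 c : C, c <> 0 &
    tends (locally' s0) (fun s => (s - s0) * (N s / (D s * G (u * s + v)))) c.
Proof.
move=> u0 E Nc N0 Dc D0.
have [R [R0 Rc RE]] := double_gamma_simple_zero tau_gt0 dgG k l irr.
have Rl : tends (locally s0) (fun s => R (u * s + v)) (R (- lam tau k l)).
  apply: (@tends_comp _ _ _ (locally (- lam tau k l)) (fun s => u * s + v) R) => //.
  by rewrite -E; apply: locally_affine.
have DR0 : D s0 * u * R (- lam tau k l) <> 0 by do 2 (apply: Cmult_neq_0 => //).
exists (N s0 / (D s0 * u * R (- lam tau k l))).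
  apply: Cmult_neq_0 => // E0; apply: C1_nz; rewrite -(Cinv_l _ DR0) E0; ring.
have L : tends (locally s0) (fun s => N s / (D s * u * R (u * s + v)))
    (N s0 / (D s0 * u * R (- lam tau k l))).
  by apply: tends_div => //; apply: tends_mul => //; apply: tends_mul (tends_const _).
apply: (tends_ext_loc (tends_locally' L)).
have n1 : locally s0 (fun s => D s <> 0) by apply: tends_neq0 D0 Dc.
have n2 : locally s0 (fun s => R (u * s + v) <> 0) by apply: tends_neq0 R0 Rl.
have n3 : locally s0 (fun s => G (u * s + v) = (u * s + v + lam tau k l) * R (u * s + v)).
  by move: RE; rewrite -E => /(@locally_affine u v s0).
rewrite /locally' /within.
apply: (filterS (filter_and _ _ n1 (filter_and _ _ n2 n3))) => s [Ds [Rs GE]] ss0.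
rewrite {}GE.
have -> : u * s + v + lam tau k l = u * (s - s0).
  transitivity (u * (s - s0) + (u * s0 + v) + lam tau k l); first ring.
  by rewrite E; ring.
have s0n : s - s0 <> 0 by apply: Cminus_eq_contra.
by field.
Qed.

Lemma in_lattice_sub (x y : C) : in_lattice tau x -> in_lattice tau y -> in_lattice tau (x - y).
Proof.
move=> [u [v ->]] [u' [v' ->]]; exists (u - u')%Z, (v - v')%Z.
rewrite !minus_IZR !RtoC_minus; ring.
Qed.

Lemma in_lattice_opp (x : C) : in_lattice tau x -> in_lattice tau (- x).
Proof.
have -> : - x = - lam tau 0 0 - x by rewrite lamE /= Rmult_0_l Rplus_0_l; ring.
exact: in_lattice_sub (in_lattice_lam _ _ _).
Qed.

Hypothesis gena : forall i j : 'I_p, (i < j)%N -> ~ in_lattice tau (a i - a j).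
Hypothesis genb : forall i j : 'I_q, (i < j)%N -> ~ in_lattice tau (b i - b j).
Hypothesis genab : forall (i : 'I_p) (j : 'I_q), ~ in_lattice tau (a i - b j).

Lemma generic_neq (r : nat) (c : 'I_r -> C) :
  (forall i j : 'I_r, (i < j)%N -> ~ in_lattice tau (c i - c j)) ->
  forall i j : 'I_r, i <> j -> ~ in_lattice tau (c i - c j).
Proof.
move=> genc i j ij; have [lt_ij|lt_ji|/val_inj //] := ltngtP i j; first exact: genc.
move=> /in_lattice_opp; have -> : - (c i - c j) = c j - c i by ring.
exact: genc.
Qed.

(** The functions [G (x - s)] and [G (1 + tau - x + s)] do not vanish at [s]
    when [x] and [s] are incongruent modulo the lattice. *)
Lemma incongruent_neq0 (x s : C) : ~ in_lattice tau (x - s) ->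
  G (x - s) <> 0 /\ G (1 + tau - x + s) <> 0.
Proof.
move=> xs; split; apply: (double_gamma_neq0_lattice tau_gt0 dgG) => //.
move=> /in_lattice_opp H1; apply: xs.
have -> : x - s = - (1 + tau - x + s) - - lam tau 1 1 by rewrite lamE /= RtoC_plus RtoC_mult; ring.
exact: in_lattice_sub H1 (in_lattice_lam _ _ _).
Qed.

Lemma incongruent_shift (x y z : C) : in_lattice tau z -> ~ in_lattice tau (x - y) ->
  ~ in_lattice tau (x - (y + z)).
Proof.
move=> zl xy H1; apply: xy.
have -> : x - y = (x - (y + z)) - (- z) by ring.
exact: in_lattice_sub H1 (in_lattice_opp zl).
Qed.

(** Genericity makes every other factor nonzero at the points where one of the
    factors of the denominator vanishes. *)
Lemma calG_pole_right (j : 'I_p) (l k : nat) : (n <= j)%N ->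
  exists2 c : C, c <> 0 & tends (locally' (a j + INR l * tau + INR k))
    (fun s => (s - (a j + INR l * tau + INR k)) * g s) c.
Proof.
move=> nj; set s0 := _ + _.
have s0E : s0 = a j + lam tau l k by rewrite /s0 /lam; ring.
have zl : in_lattice tau (lam tau l k).
  by have -> : lam tau l k = - - lam tau l k by [ring]; apply/in_lattice_opp/in_lattice_lam.
have n1 : - RtoC 1 <> 0 by move=> /(f_equal (@fst R R)) /=; lra.
have HA i : i <> j -> G (a i - s0) <> 0 /\ G (1 + tau - a i + s0) <> 0.
  move=> ij; apply: incongruent_neq0; rewrite s0E; apply: incongruent_shift => //.
  exact: generic_neq.
have HB i : G (b i - s0) <> 0 /\ G (1 + tau - b i + s0) <> 0.
  apply: incongruent_neq0; rewrite s0E; apply: incongruent_shift => //.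
  move=> /in_lattice_opp; have -> : - (b i - a j) = a j - b i by ring.
  exact: genab.
pose N s := \Cprod_(i < q | (i < m)%N) G (b i - s)
   * \Cprod_(i < p | (i < n)%N) G (1 + tau - a i + s).
pose D s := \Cprod_(i < q | (m <= i)%N) G (1 + tau - b i + s)
   * \Cprod_(i < p | (n <= i)%N && (i != j)) G (a i - s).
have [|||||c c0 Hc] := @simple_pole N D (- RtoC 1) (a j) s0 l k n1.
- rewrite s0E; ring.
- by apply: tends_mul; apply: tends_prod => i _; [apply: cont_neg_shift | apply: cont_pos_shift].
- apply: Cmult_neq_0; apply: Cprod_neq0 => i Hi; first by case: (HB i).
  by apply: (proj2 (HA i _)) => ij; move: Hi; rewrite ij ltnNge nj.
- by apply: tends_mul; apply: tends_prod => i _; [apply: cont_pos_shift | apply: cont_neg_shift].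
- apply: Cmult_neq_0; apply: Cprod_neq0 => i Hi; first by case: (HB i).
  by apply: (proj1 (HA i _)) => ij; move: Hi; rewrite ij eqxx andbF.
exists c => //; apply: (tends_ext Hc) => s; congr (_ * _).
rewrite /g /calG (bigD1 (P := fun i : 'I_p => (n <= i)%N) j) //= /N /D.
have -> : - RtoC 1 * s + a j = a j - s by ring.
by rewrite -Cmult_assoc; congr (_ / (_ * _)); apply: Cmult_comm.
Qed.

Lemma calG_pole_left (j : 'I_q) (l k : nat) : (m <= j)%N -> (1 <= l)%N -> (1 <= k)%N ->
  exists2 c : C, c <> 0 & tends (locally' (b j - INR l * tau - INR k))
    (fun s => (s - (b j - INR l * tau - INR k)) * g s) c.
Proof.
move=> mj; case: l => // l _; case: k => // k _; set s0 := _ - _.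
have s0E : s0 = b j + (- lam tau l.+1 k.+1) by rewrite /s0 /lam; ring.
have zl := in_lattice_lam tau l.+1 k.+1.
have HA i : G (a i - s0) <> 0 /\ G (1 + tau - a i + s0) <> 0.
  by apply: incongruent_neq0; rewrite s0E; apply: incongruent_shift.
have HB i : i <> j -> G (b i - s0) <> 0 /\ G (1 + tau - b i + s0) <> 0.
  move=> ij; apply: incongruent_neq0; rewrite s0E; apply: incongruent_shift => //.
  exact: generic_neq.
pose N s := \Cprod_(i < q | (i < m)%N) G (b i - s)
   * \Cprod_(i < p | (i < n)%N) G (1 + tau - a i + s).
pose D s := \Cprod_(i < q | (m <= i)%N && (i != j)) G (1 + tau - b i + s)
   * \Cprod_(i < p | (n <= i)%N) G (a i - s).
have [|||||c c0 Hc] := @simple_pole N D 1 (1 + tau - b j) s0 l k C1_nz.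
- rewrite s0E /lam !S_INR !RtoC_plus; ring.
- by apply: tends_mul; apply: tends_prod => i _; [apply: cont_neg_shift | apply: cont_pos_shift].
- apply: Cmult_neq_0; apply: Cprod_neq0 => i Hi; last by case: (HA i).
  by apply: (proj1 (HB i _)) => ij; move: Hi; rewrite ij ltnNge mj.
- by apply: tends_mul; apply: tends_prod => i _; [apply: cont_pos_shift | apply: cont_neg_shift].
- apply: Cmult_neq_0; apply: Cprod_neq0 => i Hi; last by case: (HA i).
  by apply: (proj2 (HB i _)) => ij; move: Hi; rewrite ij eqxx andbF.
exists c => //; apply: (tends_ext Hc) => s; congr (_ * _).
rewrite /g /calG (bigD1 (P := fun i : 'I_q => (m <= i)%N) j) //= /N /D.
have -> : 1 * s + (1 + tau - b j) = 1 + tau - b j + s by ring.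
by rewrite (Cmult_comm _ (G _)) Cmult_assoc.
Qed.

Lemma calG_Residue (s0 c : C) :
  tends (locally' s0) (fun s => (s - s0) * g s) c -> Residue g s0 = c.
Proof.
apply: Residue_eq; apply: (filterS (factors_punctured s0)) => s; exact: calG_cont.
Qed.

(** A functional equation turns the residue at [s0] into the one at [s0 + t]. *)
Lemma Residue_shift (Phi : C -> C) (t s0 c c' : C) :
  locally' s0 (fun s => g (s + t) = Phi s * g s) -> cont Phi s0 ->
  tends (locally' s0) (fun s => (s - s0) * g s) c ->
  tends (locally' (s0 + t)) (fun s => (s - (s0 + t)) * g s) c' ->
  c' = Phi s0 * c.
Proof.
move=> E Phic Hc Hc'.
have L : tends (locally' s0) (fun s => (1 * s + t - (s0 + t)) * g (1 * s + t)) c'.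
  apply: (@tends_comp _ _ _ (locally' (s0 + t)) (fun s => 1 * s + t)
    (fun s => (s - (s0 + t)) * g s)) => //.
  by have := @locally'_affine 1 t s0 C1_nz; rewrite Cmult_1_l.
apply: (tends_unique L).
apply: (tends_ext_loc (tends_mul (tends_locally' Phic) Hc)).
apply: (filterS E) => s; rewrite Cmult_1_l => ->.
have -> : s + t - (s0 + t) = s - s0 by ring.
by rewrite Cmult_assoc (Cmult_comm (Phi s)) -Cmult_assoc.
Qed.

Lemma calG_shift1_punctured (s0 : C) : locally' s0 (fun s => g (s + 1) = F s * g s).
Proof.
apply: (filterS (filter_and _ _ (factors_punctured s0) (factors_punctured_shift 1 s0))).
by move=> s [? ?]; apply: calG_shift1.
Qed.

Lemma calG_shift_tau_punctured (s0 : C) : locally' s0 (fun s => g (s + tau) = H s * g s).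
Proof.
apply: (filterS (filter_and _ _ (factors_punctured s0) (factors_punctured_shift tau s0))).
by move=> s [? ?]; apply: calG_shift_tau.
Qed.

(** Both sides multiply [g s] into [g (s + 1 + tau)], close to every point. *)
Lemma multipliers_compatible (s : C) : cont F s -> cont H s ->
  cont F (s + tau) -> cont H (s + 1) -> F (s + tau) * H s = H (s + 1) * F s.
Proof.
move=> Fs Hs Fst Hs1.
have sh (f : C -> C) t : cont f (s + t) -> tends (locally' s) (fun x => f (x + t)) (f (s + t)).
  move=> fc; have L : tends (locally s) (fun x => f (1 * x + t)) (f (s + t)).
    apply: (@tends_comp _ _ _ (locally (s + t)) (fun x => 1 * x + t) f) => //.
    by have := @locally_affine 1 t s; rewrite Cmult_1_l.
  by apply: (tends_ext (tends_locally' L)) => x; rewrite Cmult_1_l.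
have L1 : tends (locally' s) (fun x => F (x + tau) * H x) (F (s + tau) * H s).
  by apply: tends_mul (sh F tau Fst) (tends_locally' Hs).
have L2 : tends (locally' s) (fun x => H (x + 1) * F x) (H (s + 1) * F s).
  by apply: tends_mul (sh H 1 Hs1) (tends_locally' Fs).
apply: (tends_unique L1); apply: (tends_ext_loc L2).
have f0 := factors_punctured s.
have f1 := factors_punctured_shift 1 s.
have ft := factors_punctured_shift tau s.
have f1t := factors_punctured_shift (1 + tau) s.
apply: (filterS (filter_and _ _ (filter_and _ _ f0 f1) (filter_and _ _ ft f1t))).
move=> x [[x0 x1] [xt x1t]].
have gx := calG_neq0 x0.
have e1 : x + 1 + tau = x + (1 + tau) by ring.
have e2 : x + tau + 1 = x + (1 + tau) by ring.
have E1 : g (x + (1 + tau)) = H (x + 1) * (F x * g x).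
  by rewrite -calG_shift1 // -calG_shift_tau ?e1.
have E2 : g (x + (1 + tau)) = F (x + tau) * (H x * g x).
  by rewrite -calG_shift_tau // -calG_shift1 ?e2.
have E : (H (x + 1) * F x - F (x + tau) * H x) * g x = 0.
  transitivity (H (x + 1) * (F x * g x) - F (x + tau) * (H x * g x)); first ring.
  by rewrite -E1 -E2; ring.
case: (Ceq_dec (H (x + 1) * F x) (F (x + tau) * H x)) => // ne.
by case: (Cmult_neq_0 _ _ (Cminus_eq_contra _ _ ne) gx).
Qed.

End Quotient.

(** If nonzero quantities [c] obey the recurrences along the edges of [S], the
    multiplier of a path is the quotient of its end values. *)
Lemma path_multiplier_ratio (f1 f2 : nat * nat -> C) (c : nat * nat -> C)
    (S : nat * nat -> Prop) :
  (forall l k, S (l, k) -> S (l, k.+1) ->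
     f1 (l, k) <> 0 /\ c (l, k.+1) = f1 (l, k) * c (l, k)) ->
  (forall l k, S (l, k) -> S (l.+1, k) ->
     f2 (l, k) <> 0 /\ c (l.+1, k) = f2 (l, k) * c (l, k)) ->
  forall x w y, lattice_path S x w y -> c y = path_multiplier f1 f2 x w * c x.
Proof.
move=> H1 H2 x w y; elim: w x => [|z w IH] x [] /=.
  by move=> _ -> _; ring.
move=> /andP [xz pw] lw Sw.
have Sx : S x by apply: Sw; rewrite inE eqxx.
have Sz : S z by apply: Sw; rewrite !inE eqxx orbT.
rewrite (IH z); last by split => // v vw; apply: Sw; rewrite inE vw orbT.
suff -> : c z = step_multiplier f1 f2 x z * c x by ring.
have back (u v f : C) : f <> 0 -> u = f * v -> v = / f * u.
  by move=> f0 ->; rewrite Cmult_assoc Cinv_l // Cmult_1_l.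
case: x z xz Sx Sz {IH pw lw Sw} => l k [l' k'] xz Sx Sz.
rewrite /step_multiplier; move: xz; rewrite /lattice_step /=.
case: eqP => [[? ?] _|_]; first by subst; have [] := H1 _ _ Sx Sz.
case: eqP => [[? ?] _|_]; first by subst; have [] := H2 _ _ Sx Sz.
case: eqP => [[? ?] _|_ /= /eqP [? ?]]; subst.
  by have [f0 E] := H1 _ _ Sz Sx; apply: back f0 E.
by have [f0 E] := H2 _ _ Sz Sx; apply: back f0 E.
Qed.

Theorem theorem9p4 (tau : R) (G : C -> C) (p q m n : nat)
    (a : 'I_p -> C) (b : 'I_q -> C)
    (tau_gt0 : (0 < tau)%R) (dgG : is_double_gamma tau G)
    (le_mq : (m <= q)%N) (le_np : (n <= p)%N) (gen : generic tau a b) :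
  let g := calG G tau m n a b in
  let F := calF tau m n a b in
  let H := calH tau m n a b in
  let sp (j : 'I_p) (l k : nat) : C := a j + INR l * tau + INR k in
  let cp (j : 'I_p) (l k : nat) : C := Residue g (sp j l k) in
  let sm (j : 'I_q) (l k : nat) : C := b j - INR l * tau - INR k in
  let cm (j : 'I_q) (l k : nat) : C := Residue g (sm j l k) in
  [/\ forall (j : 'I_p) (l k : nat), (n <= j)%N ->
        regular_at F (sp j l k) -> regular_at H (sp j l k) ->
        cp j l k.+1 = F (sp j l k) * cp j l k
        /\ cp j l.+1 k = H (sp j l k) * cp j l k,
      forall (j : 'I_q) (l k : nat), (m <= j)%N -> (1 <= l)%N -> (1 <= k)%N ->
        regular_nonzero_at F (sm j l k - 1) ->
        regular_nonzero_at H (sm j l k - tau) ->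
        cm j l k.+1 = cm j l k / F (sm j l k - 1)
        /\ cm j l.+1 k = cm j l k / H (sm j l k - tau),
      forall s : C,
        regular_at F s -> regular_at H s ->
        regular_at F (s + tau) -> regular_at H (s + 1) ->
        F (s + tau) * H s = H (s + 1) * F s
    & forall (j : 'I_p) (S : nat * nat -> Prop), (n <= j)%N ->
        lattice_connected S ->
        (forall l k : nat, S (l, k) -> S (l, k.+1) ->
           regular_nonzero_at F (sp j l k)) ->
        (forall l k : nat, S (l, k) -> S (l.+1, k) ->
           regular_nonzero_at H (sp j l k)) ->
        let mult := path_multiplier (fun x => F (sp j x.1 x.2))
                                    (fun x => H (sp j x.1 x.2)) in
        forall (x y : nat * nat) (w w' : seq (nat * nat)),
          lattice_path S x w y -> lattice_path S x w' y ->
          mult x w = mult x w' /\ cp j y.1 y.2 = mult x w * cp j x.1 x.2].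
Proof.
move=> g F H sp cp sm cm; have [irr gena genb genab] := gen.
have resE s0 c := @calG_Residue tau G p q m n a b tau_gt0 dgG irr s0 c.
have poleR := @calG_pole_right tau G p q m n a b tau_gt0 dgG irr gena genab.
have poleL := @calG_pole_left tau G p q m n a b tau_gt0 dgG irr genb genab.
have shiftF s0 := @calG_shift1_punctured tau G p q m n a b tau_gt0 dgG irr s0.
have shiftH s0 := @calG_shift_tau_punctured tau G p q m n a b tau_gt0 dgG le_mq le_np irr s0.
have stepF (s0 s1 c c' : C) : s1 = s0 + 1 -> regular_at F s0 ->
    tends (locally' s0) (fun s => (s - s0) * g s) c ->
    tends (locally' s1) (fun s => (s - s1) * g s) c' ->
    Residue g s1 = F s0 * Residue g s0.
  move=> -> /regular_cont Fc Hc Hc'; rewrite (resE _ _ Hc) (resE _ _ Hc').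
  exact: Residue_shift (shiftF s0) Fc Hc Hc'.
have stepH (s0 s1 c c' : C) : s1 = s0 + tau -> regular_at H s0 ->
    tends (locally' s0) (fun s => (s - s0) * g s) c ->
    tends (locally' s1) (fun s => (s - s1) * g s) c' ->
    Residue g s1 = H s0 * Residue g s0.
  move=> -> /regular_cont Hc0 Hc Hc'; rewrite (resE _ _ Hc) (resE _ _ Hc').
  exact: Residue_shift (shiftH s0) Hc0 Hc Hc'.
have recF (j : 'I_p) l k : (n <= j)%N -> regular_at F (sp j l k) ->
    cp j l k.+1 = F (sp j l k) * cp j l k.
  move=> nj Fr; have [c _ Hc] := poleR j l k nj; have [c' _ Hc'] := poleR j l k.+1 nj.
  apply: stepF Fr Hc Hc'; rewrite /sp S_INR RtoC_plus; ring.
have recH (j : 'I_p) l k : (n <= j)%N -> regular_at H (sp j l k) ->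
    cp j l.+1 k = H (sp j l k) * cp j l k.
  move=> nj Hr; have [c _ Hc] := poleR j l k nj; have [c' _ Hc'] := poleR j l.+1 k nj.
  apply: stepH Hr Hc Hc'; rewrite /sp S_INR RtoC_plus; ring.
have div (x y f : C) : f <> 0 -> x = f * y -> y = x / f.
  by move=> f0 ->; field.
split.
- by move=> j l k nj Fr Hr; split; [apply: recF | apply: recH].
- move=> j l k mj l1 k1 [Fr F0] [Hr H0].
  have [c _ Hc] := poleL j l k mj l1 k1.
  have [c1 _ Hc1] := poleL j l k.+1 mj l1 isT.
  have [c2 _ Hc2] := poleL j l.+1 k mj isT k1.
  have e1 : sm j l k.+1 = sm j l k - 1 by rewrite /sm S_INR RtoC_plus; ring.
  have e2 : sm j l.+1 k = sm j l k - tau by rewrite /sm S_INR RtoC_plus; ring.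
  rewrite -e1 in Fr F0 *; rewrite -e2 in Hr H0 *.
  split; apply: div => //.
    by apply: stepF Fr Hc1 Hc; rewrite -/(sm j l k.+1) e1 -/(sm j l k); ring.
  by apply: stepH Hr Hc2 Hc; rewrite -/(sm j l.+1 k) e2 -/(sm j l k); ring.
- move=> s Fs Hs Fst Hs1.
  by apply: (@multipliers_compatible tau G p q m n a b tau_gt0 dgG) => //; apply: regular_cont.
move=> j S nj _ SF SH mult x y w w' Pw Pw'.
have ratio u : lattice_path S x u y -> cp j y.1 y.2 = mult x u * cp j x.1 x.2.
  apply: (@path_multiplier_ratio _ _ (fun z => cp j z.1 z.2)) => l k S1 S2 /=.
    by have [Fr F0] := SF l k S1 S2; split => //; apply: recF.
  by have [Hr H0] := SH l k S1 S2; split => //; apply: recH.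
split; last exact: ratio.
(* The residues do not vanish, hence determine the multiplier. *)
have [c c0 /resE Hc] := poleR j x.1 x.2 nj.
have cx : cp j x.1 x.2 <> 0 by rewrite /cp Hc.
have E := ratio _ Pw; rewrite (ratio _ Pw') in E.
by rewrite (div _ _ _ cx (eq_trans E (Cmult_comm _ _))); field.
Qed.
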